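(* The following statements are true. (i) Let $\ell\in\{2,3\}$ and let $k$ be a positive integer. Any $\frac{3}{2}$-tough $(k+\ell-1)$-connected $(P_{2\ell+1}\cup kP_1)$-free graph with at least three vertices has a $2$-factor. (ii) Let $k$ be a positive integer. Any $\frac{3}{2}$-tough $(k+2)$-connected $(P_6\cup kP_1)$-free graph with at least three vertices has a $2$-factor.
   Context: Graphs are finite and simple. $P_n$ denotes the path on $n$ vertices; $H\cup F$ denotes the disjoint union of vertex-disjoint graphs $H$ and $F$; $kP_1$ denotes the disjoint union of $k$ copies of $P_1$ (i.e. $k$ isolated vertices). A graph $G$ is $H$-free if $G$ does not contain $H$ as an induced subgraph. A connected graph is $m$-connected if it has more than $m$ vertices and remains connected whenever fewer than $m$ vertices are deleted. A $2$-factor of $G$ is a spanning subgraph of $G$ in which every vertex has degree $2$ (not necessarily connected). For a graph $H$, $c(H)$ denotes the number of connected components of $H$, and for $S\subset V(G)$, $G-S$ is the subgraph of $G$ induced by $V(G)\setminus S$. The toughness $\tau(G)$ is $\infty$ if $G$ is complete; otherwise $\tau(G)=\min \frac{|S|}{c(G-S)}$, the minimum being over all vertex cuts $S$ of $G$, i.e. all $S\subset V(G)$ with $c(G-S)>1$. For a positive real number $t$, $G$ is $t$-tough if $\tau(G)\ge t$. *)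

(* Defs.v *)
From mathcomp Require Import all_boot all_order all_algebra.
From mathcomp Require Import reals constructive_ereal.

Set Implicit Arguments.
Unset Strict Implicit.
Unset Printing Implicit Defensive.

Import Order.TTheory GRing.Theory Num.Theory.

Record sgraph := SGraph {
  vertex :> finType;
  adj : rel vertex;
  adj_sym : symmetric adj;
  adj_irrefl : irreflexive adj }.

Definition path_adj n : rel 'I_n := 
  fun i j => (i.+1 == j) || (j.+1 == i).

Lemma path_adj_sym n : symmetric (@path_adj n).
Proof. by move=> i j; rewrite /path_adj orbC. Qed.

Lemma path_adj_irrefl n : irreflexive (@path_adj n).
Proof. by move=> i; rewrite /path_adj orbb; apply/negbTE; rewrite neq_ltn ltnSn orbT. Qed.

Definition path_graph n := SGraph (@path_adj_sym n) (@path_adj_irrefl n).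

Definition union_adj (H F : sgraph) : rel (H + F)%type := fun u v =>
  match u, v with
  | inl x, inl y => adj x y
  | inr x, inr y => adj x y
  | _, _ => false
  end.

Lemma union_adj_sym H F : symmetric (@union_adj H F).
Proof. by move=> [x|x] [y|y] //=; rewrite adj_sym. Qed.

Lemma union_adj_irrefl H F : irreflexive (@union_adj H F).
Proof. by move=> [x|x] /=; rewrite adj_irrefl. Qed.

Definition disjoint_union H F :=
  SGraph (@union_adj_sym H F) (@union_adj_irrefl H F).

Definition copies_adj k (H : sgraph) : rel ('I_k * H)%type :=
  fun u v => (u.1 == v.1) && adj u.2 v.2.

Lemma copies_adj_sym k H : symmetric (@copies_adj k H).
Proof. by move=> u v; rewrite /copies_adj eq_sym adj_sym. Qed.

Lemma copies_adj_irrefl k H : irreflexive (@copies_adj k H).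
Proof. by move=> u; rewrite /copies_adj adj_irrefl andbF. Qed.

Definition copies k H := SGraph (@copies_adj_sym k H) (@copies_adj_irrefl k H).

Definition induced_copy (H G : sgraph) : Prop :=
  exists f : H -> G, injective f /\ forall x y, adj (f x) (f y) = adj x y.

Definition is_free (H G : sgraph) : Prop := ~ induced_copy H G.

Definition del_adj (G : sgraph) (S : {set G}) : rel {x : G | x \notin S} :=
  fun x y => adj (val x) (val y).

Lemma del_adj_sym G S : symmetric (@del_adj G S).
Proof. by move=> x y; rewrite /del_adj adj_sym. Qed.

Lemma del_adj_irrefl G S : irreflexive (@del_adj G S).
Proof. by move=> x; rewrite /del_adj adj_irrefl. Qed.

Definition del (G : sgraph) (S : {set G}) :=
  SGraph (@del_adj_sym G S) (@del_adj_irrefl G S).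

Definition num_comp (H : sgraph) : nat := n_comp (@adj H) H.

(* The graph without vertices is not regarded as connected. *)
Definition connected (H : sgraph) : Prop :=
  0 < #|H| /\ forall x y : H, connect (@adj H) x y.

Definition k_connected (m : nat) (G : sgraph) : Prop :=
  [/\ connected G, m < #|G|
    & forall S : {set G}, #|S| < m -> connected (del S)].

Definition complete (G : sgraph) : bool :=
  [forall x : G, forall y : G, (x != y) ==> adj x y].

(* A graph that is not complete has a vertex cut, so that the default value
   +oo of the iterated minimum does not interfere. *)
Definition toughness (R : realType) (G : sgraph) : \bar R :=
  if complete G then +oo%E
  else \big[Order.min/+oo%E]_(S : {set G} | 1 < num_comp (del S))
         (#|S|%:R / (num_comp (del S))%:R)%R%:E.

Definition tough (R : realType) (t : R) (G : sgraph) : Prop :=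
  (t%:E <= toughness R G)%E.

(* A spanning subgraph of G is given by its adjacency relation f; it is
   irreflexive because it is contained in that of G. *)
Definition has_two_factor (G : sgraph) : Prop :=
  exists f : rel G,
    [/\ symmetric f, subrel f (@adj G) & forall x : G, #|[set y | f x y]| = 2].

(* Main.v *)
Require Import Defs.
From mathcomp Require Import all_boot all_order all_algebra.
From mathcomp Require Import zify.
From mathcomp Require Import reals constructive_ereal.

(** Why the theorem holds.  Suppose that G has no 2-factor.  Tutte's theorem
    yields disjoint sets S and T of vertices that witness this: with
    U = V \ (S u T), and calling a component D of G[U] odd when the number
    e(D,T) of edges between D and T is odd,
      2|S| + sum of d_{G-S}(y) over y in T < 2|T| + number of odd components.
    Choosing T minimal makes the witness tidy ([tidy_barrier]): T is
    independent, a vertex of T sends at most one edge into each component of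
    G[U], and every component that meets an edge from T is odd.  Writing
    e(D,T) = 2 k_D + 1 for these components, the inequality becomes
      |S| + sum of the k_D < |T|.

    Toughness then gives two components that attach to T in a spread out way.
    Delete S, and from every odd component delete all vertices with a neighbour
    in T, sparing one vertex with a single neighbour in T if there is one.
    The vertices of T end up in different components, so 3/2-toughness bounds
    the number of deleted vertices from below.  Comparing with the displayed
    inequality, more than |T| vertices have a single neighbour in T and
    lie in a component D with at least k_D + 2 vertices attached to T.  By the
    pigeonhole principle two of them, x1 in D1 and x2 in D2, have the same
    neighbour y1 in T, and D1 <> D2 ([common_neighbour]).

    Now walk from x1 inside D1 to the first other attached vertex b1, and
    likewise from x2 to b2.  For l = 2 the induced path y0 b1 .. x1 y1 x2, with y0 a
    neighbour of b1, has at least five vertices ([induced_P5]).  For l = 3 the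
    path y0 b1 .. x1 y1 x2 .. b2 y2 has at least seven ([induced_P7_both]); it can
    be chosen induced unless the neighbours of b1 in T are all neighbours of b2,
    or conversely, and then a third attached vertex b3 of D2 saves the argument
    ([induced_P7_sub]).  As D has 2 k_D + 1 edges to T spread over k_D + 2
    vertices, a single attached vertex has at most k_D neighbours in T; thus
    only k_D1 + k_D2 + 1 vertices of T (k_D1 + 1 if l = 2) are on or adjacent to
    the path.  Connectivity makes T so large that at least k vertices
    remain ([counting]): either some odd component has a single edge to T, and
    S with one vertex of T is a cut, or every k_D is positive and the degree of
    a vertex of T is at most |S| plus the number of odd components.  These k
    vertices and the path form the forbidden induced subgraph.

    The P6 case follows from l = 3, because P6 is an induced subgraph of P7.

    Tutte's theorem on 2-factors is obtained from the Tutte-Berge formula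
    ([tutte_berge]), applied to a gadget graph whose perfect matchings encode
    the 2-factors of G; the formula itself is proved along Gallai's lines. *)

Set Implicit Arguments.
Unset Strict Implicit.
Unset Printing Implicit Defensive.

Import Order.TTheory GRing.Theory Num.Theory.

(** * Components and their parities *)

Lemma odd_sum_exists (I : finType) (P : pred I) (F : I -> nat) :
  odd (\sum_(i | P i) F i) -> exists2 i, P i & odd (F i).
Proof.
move=> oddS; apply/exists_inP; apply: contraLR oddS; rewrite negb_exists_in.
move=> /forall_inP evenF; elim/big_ind: _ => //= x y /negbTE ox /negbTE oy.
by rewrite oddD ox oy.
Qed.

Lemma odd_sum_card (I : finType) (A : {set I}) (F : I -> nat) :
  odd (\sum_(i in A) F i) = odd #|[set i in A | odd (F i)]|.
Proof.
rewrite -sum1_card big_set /= big_mkcondr /=.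
apply: (big_ind2 (fun m n => odd m = odd n)) => // [m1 n1 m2 n2 e1 e2|i _].
  by rewrite !oddD e1 e2.
by case: (odd (F i)).
Qed.

(** The points moved by an involution come in pairs. *)
Lemma odd_card_involution (T : finType) (s : T -> T) (A : {set T}) :
    {in A, forall x, s x \in A} -> {in A, forall x, s (s x) = x} ->
  odd #|A| = odd #|[set x in A | s x == x]|.
Proof.
have [n] := ubnP #|A|; elim: n A => // n IH A ltAn sA sK.
have [/exists_inP[x Ax sx]|] := boolP [exists x in A, s x != x]; last first.
  rewrite negb_exists_in => /forall_inP fixA; congr (odd #|pred_of_set _|).
  apply/setP=> x; rewrite !inE; have [Ax|//] := boolP (x \in A).
  by have := fixA x Ax; rewrite negbK => ->.
pose B := A :\ x :\ s x.
have cA : #|A| = #|B|.+2.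
  by rewrite (cardsD1 x A) Ax (cardsD1 (s x) (A :\ x)) !inE sx sA.
have BA y : y \in B -> [/\ y != s x, y != x & y \in A] by rewrite !inE => /and3P[].
have cF : [set y in A | s y == y] = [set y in B | s y == y].
  apply/setP=> y; rewrite !inE; have [->|_] := eqVneq y (s x).
    by rewrite sK // eq_sym (negbTE sx) andbF.
  by have [->|_] := eqVneq y x; rewrite //= (negbTE sx) andbF.
rewrite cA /= negbK cF; apply: IH; first by rewrite cA in ltAn; lia.
- move=> y /BA[ysx yx Ay]; rewrite !inE sA // andbT; apply/andP; split.
    by apply: contra yx => /eqP/(congr1 s); rewrite !sK // => ->.
  by apply: contra ysx => /eqP/(congr1 s); rewrite sK // => ->.
- by move=> y /BA[_ _ Ay]; apply: sK.
Qed.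

Section Components.
Variables (V : finType) (e : rel V).
Hypothesis e_sym : symmetric e.
Implicit Types (A C D : {set V}) (w : V -> nat).

Definition restr A : rel V := [rel x y | [&& x \in A, y \in A & e x y]].
Definition component A x : {set V} := [set y | connect (restr A) x y].
Definition components A : {set {set V}} := [set component A x | x in A].
Definition odd_comps A w : {set {set V}} :=
  [set C in components A | odd (\sum_(x in C) w x)].

Lemma restr_csym A : connect_sym (restr A).
Proof. by apply: sym_connect_sym => x y; rewrite /restr /= e_sym andbCA. Qed.

Lemma component_refl A x : x \in component A x.
Proof. by rewrite inE. Qed.

Lemma component_eq A x y : y \in component A x -> component A y = component A x.
Proof.
rewrite inE => xy; apply/setP=> z; rewrite !inE.
by rewrite (same_connect (restr_csym A) xy).
Qed.

Lemma component_step A x y : x \in A -> y \in A -> e x y -> component A x = component A y.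
Proof. by move=> Ax Ay exy; apply/esym/component_eq; rewrite inE connect1 // /restr /= Ax Ay. Qed.

Lemma component_const (L : Type) (f : V -> L) A :
  {in A &, forall x y, e x y -> f x = f y} ->
  forall x y, y \in component A x -> f x = f y.
Proof.
move=> fE x y; rewrite inE => /connectP[p + ->].
elim: p x => //= z p IH x /andP[/and3P[Ax Az exz] /IH <-]; exact: fE.
Qed.

Lemma component_sub A x : x \in A -> component A x \subset A.
Proof.
move=> Ax; apply/subsetP=> y; rewrite inE => /connectP[p + ->].
elim: p x Ax => //= z p IH x Ax /andP[/and3P[_ Az _]]; exact: IH.
Qed.

Lemma componentsP A C x : C \in components A -> x \in C -> C = component A x /\ x \in A.
Proof.
move=> /imsetP[y Ay ->] yx; split; first by rewrite (component_eq yx).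
exact: (subsetP (component_sub Ay)).
Qed.

Lemma mem_components A x : x \in A -> component A x \in components A.
Proof. exact: imset_f. Qed.

Lemma mem_component A C x : C \in components A -> x \in A -> (component A x == C) = (x \in C).
Proof.
move=> CA Ax; apply/eqP/idP=> [<-|/(componentsP CA)[-> //]]; exact: component_refl.
Qed.

Lemma sum_components A (F : V -> nat) :
  \sum_(x in A) F x = \sum_(C in components A) \sum_(x in C) F x.
Proof.
rewrite (partition_big (component A) (mem (components A))) /=; last exact: mem_components.
apply: eq_bigr => C CA; apply: eq_bigl => x; have [Ax|nAx] := boolP (x \in A).
  exact: mem_component.
by apply/esym/negbTE; apply: contra nAx => /(componentsP CA)[].
Qed.

(** This replaces reasoning about how components split or merge: an upper
    bound on the number of odd components of another set or graph amounts to a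
    labelling that is constant along edges, since an odd label class, being a union of
    components, contains an odd one. *)
Lemma odd_labels_leq (L : finType) (f : V -> L) A w :
  {in A &, forall x y, e x y -> f x = f y} ->
  #|[set l | odd (\sum_(x in A | f x == l) w x)]| <= #|odd_comps A w|.
Proof.
move=> fE; pose h C := if [pick x in C] is Some x then Some (f x) else None.
rewrite -(card_imset _ Some_inj).
apply: leq_trans (leq_imset_card h (mem (odd_comps A w))); apply: subset_leq_card.
apply/subsetP=> _ /imsetP[l + ->]; rewrite inE big_mkcondr sum_components.
case/odd_sum_exists => C CA oddC.
have hC x : x \in C -> h C = Some (f x).
  move=> Cx; rewrite /h; case: pickP => [y Cy|/(_ x)]; last by rewrite Cx.
  by rewrite (component_const fE (y := x) (x := y)) // -(componentsP CA Cy).1.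
have [x Cx] := odd_sum_exists oddC; case: eqP => // fx _.
apply/imsetP; exists C; last by rewrite (hC x Cx) fx.
rewrite inE CA -(eq_bigr _ (fun y Cy => _ : (if f y == l then w y else 0) = w y)) //.
by move=> y Cy; have := hC y Cy; rewrite (hC x Cx) fx => -[<-]; rewrite eqxx.
Qed.

Definition touches x : pred {set V} := fun C => [exists z in C, e x z].

(** Adding x to A glues x and the components that it touches into one; all other
    components survive with their weights, even if the weights inside the
    glued component change from w to w'. *)
Lemma odd_comps_add A w w' x : x \notin A ->
    {in A, forall z, ~~ touches x (component A z) -> w' z = w z} ->
  #|odd_comps A w| + odd (\sum_(z in x |: [set z in A | touches x (component A z)]) w' z)
    <= #|odd_comps (x |: A) w'| + #|[set C in odd_comps A w | touches x C]|.
Proof.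
move=> nAx eqw; set M := x |: _.
(* None is the label of the glued component *)
pose f z := if z \in M then None else Some (component A z).
have fE : {in x |: A &, forall y z, e y z -> f y = f z}.
  have base z : e x z -> z \in A -> f z = None.
    move=> exz Az; rewrite /f !inE Az /= (_ : touches x _) ?orbT //.
    by apply/exists_inP; exists z => //; apply: component_refl.
  have fx : f x = None by rewrite /f !inE eqxx.
  move=> y z /setU1P[->|Ay] /setU1P[->|Az] // eyz.
  - by rewrite fx base.
  - by rewrite fx base // e_sym.
  have cyz := component_step Ay Az eyz.
  have neqx u : u \in A -> (u == x) = false by move=> Au; apply: contraNF nAx => /eqP<-.
  by rewrite /f !inE Ay Az cyz !neqx.
apply: leq_trans (leq_add (odd_labels_leq w' fE) (leqnn _)).
set J := [set C in _ | touches x C]; set O := odd_comps A w.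
have -> : #|O| = #|O :\: J| + #|J|.
  rewrite -(cardsID J O) addnC; congr (_ + #|pred_of_set _|).
  by apply/setIidPr/subsetP=> C; rewrite inE => /andP[].
rewrite addnAC leq_add2r; set Q := [set l | _].
have Msum : \sum_(z in x |: A | f z == None) w' z = \sum_(z in M) w' z.
  apply: eq_bigl => z; rewrite /f; case: ifP => Mz; last by rewrite andbF.
  by rewrite eqxx andbT; move: Mz; rewrite !inE => /orP[->//|/andP[-> _]]; rewrite orbT.
have NQ : (None \in Q) = odd (\sum_(z in M) w' z) by rewrite inE Msum.
rewrite (cardsD1 None Q) NQ addnC leq_add2l -(card_imset _ Some_inj).
apply: subset_leq_card; apply/subsetP=> _ /imsetP[C CO ->]; rewrite !inE /=.
move: CO; rewrite !inE => /andP[nadj /andP[CA oddC]].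
rewrite CA oddC /= in nadj.
rewrite (_ : \sum_(z | _) _ = \sum_(z in C) w z) //.
have CM z : z \in C -> z \notin M.
  move=> Cz; have [Cdef Az] := componentsP CA Cz; rewrite !inE Az -Cdef negb_or nadj andbT.
  by apply: contraNneq nAx => <-.
rewrite (eq_bigl (mem C)); last first.
  move=> z; rewrite /f; case: ifP => Mz.
    by rewrite andbF; apply/esym/negbTE; apply: contraL Mz => /CM.
  move: Mz; rewrite !inE; have [->//|zx /= Mz] := eqVneq z x.
  have [Az|nAz] := boolP (z \in A).
    by rewrite -(mem_component CA Az) /=; apply/eqP/eqP => [[]|->].
  by apply/esym/negbTE; apply: contra nAz => /(componentsP CA)[].
by apply: eq_bigr => z Cz; have [Cdef Az] := componentsP CA Cz; apply: eqw => //; rewrite -Cdef.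
Qed.

Lemma odd_sum_components A w (P : pred {set V}) :
  odd (\sum_(z in [set z in A | P (component A z)]) w z)
    = odd #|[set C in odd_comps A w | P C]|.
Proof.
rewrite big_set /= (partition_big (component A) (fun C => (C \in components A) && P C)) /=; last first.
  by move=> z /andP[Az ->]; rewrite mem_components.
rewrite (eq_bigl (mem [set C in components A | P C])) => [|C]; last by rewrite !inE.
rewrite odd_sum_card; congr (odd #|pred_of_set _|); apply/setP=> C; rewrite !inE.
have [CA /=|//] := boolP (C \in components A); rewrite andbC; have [PC|] := boolP (P C); last by rewrite !andbF.
rewrite !andbT; congr odd; apply: eq_bigl => z; have [Az|nAz] := boolP (z \in A).
  rewrite /= -(mem_component CA Az); have [cz|] := eqVneq (component A z) C; last by rewrite andbF.
  by rewrite andbT unfold_in Az cz PC.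
by rewrite unfold_in (negbTE nAz); apply/esym/negbTE; apply: contra nAz => /(componentsP CA)[].
Qed.

Lemma component_isolated A x : x \in A -> (forall y, y \in A -> e x y = false) ->
  component A x = [set x].
Proof.
move=> Ax nx; apply/setP=> y; rewrite inE; apply/idP/eqP=> [xy|->]; last exact: component_refl.
have := component_const (f := fun z => z == x) (A := A) _ xy; rewrite eqxx => H.
apply/eqP/esym/H => u v Au Av euv; have [ux|_] := eqVneq u x; last first.
  by have [vx|//] := eqVneq v x; rewrite vx e_sym nx in euv.
by rewrite ux nx in euv.
Qed.

End Components.

(** * The Tutte-Berge formula *)

Section TutteBerge.
Variables (V : finType) (e : rel V).
Hypotheses (e_sym : symmetric e) (e_irr : irreflexive e).
Implicit Types (W X : {set V}) (M N : {ffun V -> V}).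

(** A matching inside W is encoded as an involution that moves vertices only
    along edges inside W; its fixed points in W are the unmatched vertices. *)
Definition matching W M : bool :=
  [forall x, (M (M x) == x) && ((M x != x) ==> [&& x \in W, M x \in W & e x (M x)])].
Definition missed W M : {set V} := [set x in W | M x == x].
Definition max_matching W M : bool :=
  matching W M && [forall N, matching W N ==> (#|missed W M| <= #|missed W N|)].

Lemma matchingP W M :
  reflect ((forall x, M (M x) = x) /\
           (forall x, M x != x -> [/\ x \in W, M x \in W & e x (M x)]))
          (matching W M).
Proof.
apply: (iffP forallP) => [mM|[MM Me] x]; last first.
  by rewrite MM eqxx; apply/implyP=> /Me[-> -> ->].
by split=> x; have /andP[/eqP MM /implyP Me] := mM x; first exact: MM; move=> /Me/and3P[].
Qed.

Lemma max_matchingP W M :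
  reflect (matching W M /\ forall N, matching W N -> #|missed W M| <= #|missed W N|)
          (max_matching W M).
Proof.
apply: (iffP andP) => -[mM maxM]; split=> //; first by move=> N; move/forallP: maxM => /(_ N)/implyP.
by apply/forallP=> N; apply/implyP; apply: maxM.
Qed.

Lemma max_matching_exists W : exists M, max_matching W M.
Proof.
have m1 : matching W [ffun x => x].
  by apply/matchingP; split=> x; rewrite !ffunE ?eqxx.
case: (@arg_minnP _ [ffun x => x] (matching W) (fun M => #|missed W M|)) => // M mM minM.
by exists M; apply/max_matchingP.
Qed.

Lemma matching_in W M x : matching W M -> x \in W -> M x \in W.
Proof.
move=> /matchingP[_ Me] Wx; have [->//|/Me[]//] := eqVneq (M x) x.
Qed.

Lemma missed_parity W M : matching W M -> odd #|missed W M| = odd #|W|.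
Proof.
move=> mM; rewrite /missed -odd_card_involution // => x Wx; first exact: matching_in.
by case/matchingP: mM.
Qed.

Section Switch.
Variables (W : {set V}) (M N : {ffun V -> V}) (w : V).
Hypotheses (mM : matching W M) (mN : matching W N) (Nw : N w = w).
Let g x := N (M x).
(** The alternating path of M and N that starts at w, a vertex unmatched by N,
    as the orbit of w under N o M. *)
Definition alt : {set V} := [set x | fconnect (fun x => N (M x)) w x].

Let MK x : M (M x) = x. Proof. by case/matchingP: mM. Qed.
Let NK x : N (N x) = x. Proof. by case/matchingP: mN. Qed.
Let g_inj : injective g.
Proof. by move=> x y /(congr1 N); rewrite /g !NK => /(congr1 M); rewrite !MK. Qed.


(** N reverses the orbit: in terms of g = N o M, it maps g^i w to g^{-i} w. *)
Lemma iter_alt i : iter i g (N (iter i g w)) = w.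
Proof.
elim: i => [|i IH]; first exact: Nw.
by rewrite iterSr iterS {2}/g NK /g MK.
Qed.

Lemma alt_start : w \in alt. Proof. by rewrite inE connect0. Qed.

Lemma alt_N x : (N x \in alt) = (x \in alt).
Proof.
suff H y : y \in alt -> N y \in alt by apply/idP/idP=> /H; rewrite ?NK.
rewrite !inE => /iter_findex <-; rewrite fconnect_sym //.
by rewrite -[X in fconnect _ _ X](iter_alt (findex g w y)) fconnect_iter.
Qed.

Lemma alt_M x : (M x \in alt) = (x \in alt).
Proof.
rewrite -(alt_N (M x)) !inE; apply/esym.
exact: (same_connect_r (fconnect_sym g_inj) (fconnect1 g x) w).
Qed.

(** An alternating path has two ends, and one of them is w.  In the
    cyclic order of the orbit, M acts as i |-> -i-1, and 2i+1 = 0 has at most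
    one solution modulo the orbit length, which is odd as soon as there is one. *)
Lemma alt_missed x y : x \in alt -> y \in alt -> M x = x -> M y = y -> x = y.
Proof.
have key u : u \in alt -> M u = u -> exists2 i, u = iter i g w & iter (2 * i).+1 g w = w.
  rewrite inE => /iter_findex; set i := findex _ _ _ => iu Mu; exists i => //.
  by rewrite mul2n -addnn -addnS iterD iterS iu {2}/g Mu -iu iter_alt.
have mulw n m : iter n g w = w -> iter (m * n) g w = w.
  by move=> nw; elim: m => // m IH; rewrite mulSn iterD IH.
move=> xC yC Mx My; have [i -> iw] := key x xC Mx; have [j -> jw] := key y yC My.
wlog le_ij : i j iw jw / i <= j => [H|].
  by case/orP: (leq_total i j) => le_ij; [apply: H | apply/esym/H].
have dw : iter (2 * (j - i)) g w = w.
  by move: jw; rewrite (_ : (2 * j).+1 = 2 * (j - i) + (2 * i).+1) ?iterD ?iw //; lia.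
have dw' : iter (j - i) g w = w.
  have := mulw _ (j - i) iw.
  by rewrite (_ : _ * _ = (j - i) + i * (2 * (j - i))) ?iterD ?(mulw _ i dw) //; lia.
by rewrite -[in RHS](subnKC le_ij) iterD dw'.
Qed.

Definition switch M1 N1 : {ffun V -> V} := [ffun x => if x \in alt then N1 x else M1 x].

Lemma switch_matching M1 N1 : matching W M1 -> matching W N1 ->
  (forall x, (M1 x \in alt) = (x \in alt)) -> (forall x, (N1 x \in alt) = (x \in alt)) ->
  matching W (switch M1 N1).
Proof.
move=> /matchingP[M1K M1e] /matchingP[N1K N1e] aM aN; apply/matchingP.
by split=> x; have [Cx|/negbTE Cx] := boolP (x \in alt);
  rewrite !ffunE Cx ?aM ?aN ?Cx //; first [exact: N1e | exact: M1e].
Qed.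

Lemma switch_missed :
  #|missed W (switch M N)| + #|missed W (switch N M)| = #|missed W M| + #|missed W N|.
Proof.
have half P Q : #|missed W (switch P Q)| = #|missed W Q :&: alt| + #|missed W P :\: alt|.
  rewrite -(cardsID alt); congr (_ + _); apply: eq_card => x;
    rewrite ?in_setI ?in_setD; have [Cx|Cx] := boolP (x \in alt);
    by rewrite ?andbF ?andbT //= /missed !in_set ffunE ?Cx ?(negbTE Cx).
rewrite !half -(cardsID alt (missed W M)) -(cardsID alt (missed W N)); lia.
Qed.

End Switch.

(** Exchanging M and N along the path preserves the total number of unmatched
    vertices, and neither of the two results can do better than the maximum. *)
Lemma switch_max W M N w : max_matching W M -> max_matching W N -> N w = w ->
  max_matching W (switch M N w M N).
Proof.
move=> /max_matchingP[mM maxM] /max_matchingP[mN maxN] Nw.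
have aM := alt_M mM mN Nw; have aN := alt_N mM mN Nw.
have mMN := switch_matching mM mN aM aN; have mNM := switch_matching mN mM aN aM.
have sumE := switch_missed w mM mN.
apply/max_matchingP; split=> // P mP; have := maxM P mP; have := maxN _ mNM; lia.
Qed.

(** Gallai's relation: x and y are related if no maximum matching leaves both
    unmatched.  [both_missed W x x] says that some maximum matching leaves
    x unmatched. *)
Definition both_missed W x y : bool :=
  [exists M, [&& max_matching W M, M x == x & M y == y]].
Definition gallai W x y : bool := (x == y) || ~~ both_missed W x y.

Lemma both_missed_sym W : symmetric (both_missed W).
Proof. by move=> x y; apply: eq_existsb => M; rewrite [X in _ && X]andbC. Qed.

Lemma gallai_sym W : symmetric (gallai W).
Proof. by move=> x y; rewrite /gallai eq_sym both_missed_sym. Qed.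

(** If a maximum matching M misses v and z, take a maximum matching N that
    misses w and switch M along the alternating path from w: the result misses
    w, and still misses v or z, because the path ends in at most one of them. *)
Lemma gallai_trans W v w z : both_missed W w w ->
  gallai W v w -> gallai W w z -> gallai W v z.
Proof.
rewrite /gallai => /existsP[N /and3P[maxN /eqP Nw _]].
have [->//|vw /= nvw] := eqVneq v w; have [<-|wz /= nwz] := eqVneq w z.
  by rewrite nvw orbT.
have [//|vz /=] := eqVneq v z; apply/negP=> /existsP[M /and3P[maxM /eqP Mv /eqP Mz]].
have [[mM _] [mN _]] := (max_matchingP _ _ maxM, max_matchingP _ _ maxN).
have maxS := switch_max maxM maxN Nw; set S := switch _ _ _ _ _ in maxS.
have Sw : S w == w by rewrite ffunE alt_start Nw.
have [va|nva] := boolP (v \in alt M N w); last first.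
  by case/existsP: nvw; exists S; rewrite maxS Sw ffunE (negbTE nva) Mv eqxx.
have [za|nza] := boolP (z \in alt M N w); last first.
  by case/existsP: nwz; exists S; rewrite maxS Sw ffunE (negbTE nza) Mz eqxx.
by rewrite (alt_missed mM mN Nw va za Mv Mz) eqxx in vz.
Qed.

(** Otherwise the edge xy could be added to the matching. *)
Lemma gallai_adj W x y : x \in W -> y \in W -> e x y -> gallai W x y.
Proof.
move=> Wx Wy exy; apply/orP; right; apply/negP=> /existsP[M /and3P[maxM /eqP Mx /eqP My]].
have [/[dup] mM /matchingP[MK Me] minM] := max_matchingP _ _ maxM.
have nxy : x != y by apply: contraTneq exy => ->; rewrite e_irr.
pose P : {ffun V -> V} := [ffun z => if z == x then y else if z == y then x else M z].
have Px : P x = y by rewrite ffunE eqxx.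
have Py : P y = x by rewrite ffunE eqxx eq_sym (negbTE nxy).
have PM z : z != x -> z != y -> P z = M z by rewrite ffunE => /negbTE-> /negbTE->.
have mP : matching W P.
  apply/matchingP; split=> z; (have [->|zx] := eqVneq z x; first by rewrite Px ?Py);
    (have [->|zy] := eqVneq z y; first by rewrite Py ?Px // e_sym); rewrite (PM z zx zy).
    rewrite PM ?MK //; first by apply: contra zx => /eqP/(congr1 M); rewrite MK Mx => ->.
    by apply: contra zy => /eqP/(congr1 M); rewrite MK My => ->.
  exact: Me.
suff : missed W P \proper missed W M.
  by move/proper_card; rewrite ltnNge minM.
apply/properP; split; last by exists x; rewrite !inE ?Wx ?Mx ?Px ?eqxx //= eq_sym.
apply/subsetP=> z; rewrite !inE => /andP[->]; have [->|zx] := eqVneq z x; first by rewrite Mx eqxx.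
by have [->|zy] := eqVneq z y; rewrite ?My ?eqxx // PM.
Qed.

(** The half of the formula that provides a witness X.  If some vertex v is covered by
    all maximum matchings, delete it and add it to X.  Otherwise Gallai's
    relation is an equivalence whose classes are unions of components; a
    maximum matching leaves at most one vertex of each class unmatched and
    matches the others within the class, so X = set0 works. *)
Theorem tutte_berge W : exists M X,
  [/\ matching W M, X \subset W
    & #|missed W M| + #|X| <= #|odd_comps e (W :\: X) (fun=> 1)|].
Proof.
have [n] := ubnP #|W|; elim: n W => // n IH W ltWn.
have [M maxM] := max_matching_exists W.
have [mM minM] := max_matchingP _ _ maxM; have [MK Me] := matchingP _ _ mM.
have [/forall_inP iness|] := boolP [forall v in W, both_missed W v v]; last first.
  rewrite negb_forall_in => /exists_inP[v Wv essv].
  have cW := cardsD1 v W; rewrite Wv in cW.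
  have [|M' [X' [mM' sX' defX']]] := IH (W :\ v); first by lia.
  have [M'K M'e] := matchingP _ _ mM'.
  have M'v : M' v = v.
    by apply: contraTeq isT => /M'e[]; rewrite !inE eqxx.
  have mM'W : matching W M'.
    apply/matchingP; split=> // x /M'e[]; rewrite !inE.
    by move=> /andP[_ ->] /andP[_ ->] ->.
  have cM' : #|missed W M'| = #|missed (W :\ v) M'|.+1.
    rewrite (cardsD1 v) !inE Wv M'v eqxx add1n; congr _.+1.
    by apply: eq_card => x; rewrite !inE andbA.
  have lt : #|missed W M| < #|missed W M'|.
    rewrite ltnNge; apply: contra essv => leM'; apply/existsP; exists M'.
    rewrite M'v eqxx !andbT; apply/max_matchingP; split=> // N mN.
    exact: leq_trans leM' (minM N mN).
  have oo : odd #|missed W M| = odd #|missed W M'| by rewrite !missed_parity.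
  have vX' : v \notin X' by apply/negP=> /(subsetP sX'); rewrite !inE eqxx.
  exists M, (v |: X'); split=> //.
    by rewrite subUset sub1set Wv (subset_trans sX') // subsetDl.
  rewrite cardsU1 vX' -setDDl add1n; apply: leq_trans defX'; lia.
exists M, set0; split; rewrite ?sub0set // cards0 addn0 setD0.
pose f x := [set y in W | gallai W x y].
have fE : {in W &, forall x y, gallai W x y -> f x = f y}.
  move=> x y Wx Wy gxy; apply/setP=> z; rewrite !inE; have [Wz /=|//] := boolP (z \in W).
  by apply/idP/idP; apply: gallai_trans; rewrite ?iness // gallai_sym.
apply: leq_trans (odd_labels_leq e_sym (f := f) (A := W) (fun=> 1) _); last first.
  by move=> x y Wx Wy exy; apply: fE => //; apply: gallai_adj.
have f_inj : {in missed W M &, injective f}.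
  move=> x y; rewrite !inE => /andP[Wx /eqP Mx] /andP[Wy /eqP My] /setP/(_ y).
  rewrite !inE Wy /gallai eqxx /= => /orP[/eqP//|]; case/existsP.
  by exists M; rewrite maxM Mx My !eqxx.
rewrite -(card_in_imset f_inj); apply: subset_leq_card.
apply/subsetP=> l /imsetP[x /setIdP[Wx Mx] ->]; rewrite inE.
pose A := [set y in W | f y == f x].
have -> : \sum_(y in W | f y == f x) 1 = #|A|.
  by rewrite -sum1_card; apply: eq_bigl => y; rewrite inE.
rewrite (@odd_card_involution _ M A) => [|y|y _]; last exact: MK; last first.
  rewrite !inE => /andP[Wy /eqP <-]; have Wmy := matching_in mM Wy.
  rewrite Wmy; have [->|My] := eqVneq (M y) y; first by rewrite eqxx.
  apply/eqP/esym/fE => //.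
  by have [_ _ eyM] := Me y My; apply: gallai_adj.
rewrite (_ : [set y in A | _] = [set x]) ?cards1 //.
apply/setP=> y; rewrite !inE; apply/andP/eqP => [[/andP[Wy /eqP fy] My]|->].
  by apply: f_inj => //; rewrite inE ?Wy ?Wx.
by rewrite Wx eqxx.
Qed.

End TutteBerge.

(** * Barriers to 2-factors *)

Lemma card_sigma_pairs (V : finType) (B : {set V}) (R : V -> {set V}) :
  #|[set p : V * V | (p.1 \in B) && (p.2 \in R p.1)]| = \sum_(v in B) #|R v|.
Proof.
rewrite -sum1_card big_set /=.
rewrite -(pair_big_dep (fun v => v \in B) (fun v u => u \in R v) (fun _ _ => 1)) /=.
by apply: eq_bigr => v _; rewrite sum1_card.
Qed.

Section TwoFactorBarrier.
Variables (V : finType) (e : rel V).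
Hypotheses (e_sym : symmetric e) (e_irr : irreflexive e).

Definition two_factor (f : rel V) : Prop :=
  [/\ symmetric f, subrel f e & forall x, #|[set y | f x y]| = 2].
Definition nbr (B : {set V}) (x : V) : {set V} := [set y in B | e x y].
Definition degin (B : {set V}) (x : V) : nat := #|nbr B x|.
(** Tutte's obstruction to a 2-factor.  The weight of x is its number of
    neighbours in T, so that the weight of a component is its number of edges
    to T. *)
Definition barrier (S T : {set V}) : bool :=
  [disjoint S & T] &&
  (2 * #|S| + \sum_(y in T) degin (~: S) y
     < 2 * #|T| + #|odd_comps e (~: (S :|: T)) (degin T)|).

Local Notation H := ((V * bool) + (V * V))%type.

(** A vertex v is replaced by two copies [inl (v, i)] and an edge vu by two
    adjacent half-edges [inr (v, u)] and [inr (u, v)]; the copies of v are adjacent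
    to the half-edges at v.  In a perfect matching, the edge vu is in the
    2-factor exactly when its halves are matched to copies of v and u rather
    than to each other. *)
Definition gadget : rel H := fun z t =>
  match z, t with
  | inl (a, _), inr (b, c) => (a == b) && e b c
  | inr (b, c), inl (a, _) => (a == b) && e b c
  | inr (a, b), inr (c, d) => [&& a == d, b == c & e a b]
  | _, _ => false
  end.

Definition gverts : {set H} := [set z | if z is inr (a, b) then e a b else true].

Lemma gadget_sym : symmetric gadget.
Proof.
move=> [[a i]|[a b]] [[c j]|[c d]] //=; have [->|_] := eqVneq a d; have [->|_] := eqVneq b c;
  by rewrite ?eqxx ?andbF //= e_sym.
Qed.

Lemma gadget_irr : irreflexive gadget.
Proof. by move=> [[a i]|[a b]] //=; case: eqP => //= ->; rewrite e_irr andbF. Qed.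

Lemma gadget_two_factor M : matching gadget gverts M -> missed gverts M = set0 ->
  exists f, two_factor f.
Proof.
move=> /matchingP[MK Me] noM.
have Mmoves z : z \in gverts -> M z != z.
  move=> Wz; apply/eqP=> Mz.
  have : z \in missed gverts M by apply/setIdP; rewrite Mz.
  by rewrite noM inE.
pose f v u := e v u && (M (inr (v, u)) != inr (u, v)).
have fE v u : f v u <-> exists i, M (inl (v, i)) = inr (v, u).
  split=> [/andP[evu Mvu]|[i Mi]].
    have Wvu : inr (v, u) \in gverts by rewrite inE.
    have [_ _] := Me _ (Mmoves _ Wvu).
    case E : (M _) Mvu => [[a i]|[a b]] /= Mvu; last first.
      by case/and3P=> /eqP vb /eqP ua _; rewrite -vb -ua eqxx in Mvu.
    by case/andP=> /eqP av _; subst a; exists i; rewrite -E MK.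
  have Wvi : inl (v, i) \in gverts by rewrite inE.
  have [_ _] := Me _ (Mmoves _ Wvi); rewrite Mi /= eqxx /= => evu.
  by rewrite /f evu -Mi MK.
have Mi v i : exists u, M (inl (v, i)) = inr (v, u).
  have Wvi : inl (v, i) \in gverts by rewrite inE.
  have [_ _] := Me _ (Mmoves _ Wvi); case: (M _) => // [[a b]] /= /andP[/eqP <- _].
  by exists b.
exists f; split=> [v u|v u /andP[]//|v].
  rewrite /f e_sym; congr (_ && ~~ _); apply/eqP/eqP=> <-; exact: MK.
have [[u0 M0] [u1 M1]] := (Mi v false, Mi v true).
have u01 : u0 != u1.
  by apply/eqP=> u01; have := MK (inl (v, true)); rewrite M1 -u01 -M0 MK.
rewrite (_ : [set y | _] = [set u0; u1]) ?cards2 ?u01 //.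
apply/setP=> u; rewrite !inE; apply/idP/orP=> [/fE[[]]|[] /eqP ->].
- by rewrite M1 => -[->]; right.
- by rewrite M0 => -[->]; left.
- by apply/fE; exists false.
- by apply/fE; exists true.
Qed.

Section FromGadget.
Variable X : {set H}.
Hypotheses (sXW : X \subset gverts)
  (defX : #|X| < #|odd_comps gadget (gverts :\: X) (fun=> 1)|)
  (minX : forall Y : {set H}, Y \subset gverts -> #|Y| < #|X| ->
     #|odd_comps gadget (gverts :\: Y) (fun=> 1)| <= #|Y|).

Let A := gverts :\: X.
Let cmp z := component gadget A z.
Let O := odd_comps gadget A (fun=> 1).

(** Removing x from a smallest violating set X must destroy the violation.
    With j odd components at x, the excess changes by 1 - j if j is odd and by 2 - j
    if j is even. *)
Let three x : x \in X -> 2 < #|[set C in O | touches gadget x C]|.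
Proof.
move=> Xx; have Wx := subsetP sXW x Xx.
have nAx : x \notin A by rewrite !inE Xx.
have := odd_comps_add gadget_sym (w := fun=> 1) (w' := fun=> 1) nAx (fun _ _ _ => erefl).
rewrite -/A -/O; set N := [set z in A | _]; set J := [set C in O | _].
rewrite big_setU1 /=; last by rewrite inE (negbTE nAx).
rewrite oddD (odd_sum_components gadget_sym A (fun=> 1) (touches gadget x)) -/O -/J.
have -> : x |: A = gverts :\: (X :\ x).
  apply/setP=> z; rewrite in_setU1 !in_setD in_set1; have [->|_] := eqVneq z x.
    by rewrite Wx.
  by rewrite andTb.
have cX : #|X| = #|X :\ x|.+1 by rewrite (cardsD1 x X) Xx.
have := minX (subset_trans (subsetDl X [set x]) sXW); rewrite cX ltnSn => /(_ isT).
move: defX; rewrite -/A -/O cX; move: #|_ :\ x| #|O| #|odd_comps _ _ _| #|J| => a b c d.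
by case: d => [|[|[|d]]] //=; lia.
Qed.

Let adj_comp x C : C \in [set C in O | touches gadget x C] ->
  exists z, [/\ z \in A, gadget x z & C = cmp z].
Proof.
rewrite !inE => /andP[/andP[CA _] /exists_inP[z Cz xz]]; exists z.
by have [-> Az] := componentsP gadget_sym CA Cz.
Qed.

Let AE z : (z \in A) = (z \notin X) && (z \in gverts).
Proof. by rewrite in_setD. Qed.

Let W_copy v i : inl (v, i) \in gverts. Proof. by rewrite inE. Qed.
Let W_half v u : (inr (v, u) \in gverts) = e v u. Proof. by rewrite inE. Qed.

(** Otherwise the remaining copy of v would join all the neighbours of the first. *)
Let copies_X v i : inl (v, i) \in X -> inl (v, ~~ i) \in X.
Proof.
move=> Xvi; apply/negPn/negP=> nX.
suff s1 : [set C in O | touches gadget (inl (v, i)) C] \subset [set cmp (inl (v, ~~ i))].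
  by have := leq_trans (three Xvi) (subset_leq_card s1); rewrite cards1.
apply/subsetP=> C /adj_comp[z [Az gz ->]]; rewrite inE; apply/eqP.
apply: (component_step gadget_sym) => //; first by rewrite AE nX ?W_copy ?W_half.
by rewrite gadget_sym; case: z gz {Az} => [[]|[]].
Qed.

(** X consists of both copies of the vertices of S and of all half-edges at the
    vertices of T; isolated vertices count as members of T. *)
Let S : {set V} := [set v | inl (v, false) \in X].
Let T : {set V} := [set v | (v \notin S) && [forall u, e v u ==> (inr (v, u) \in X)]].

Let X_copy v i : (inl (v, i) \in X) = (v \in S).
Proof.
rewrite inE; case: i => //.
by apply/idP/idP=> /copies_X.
Qed.

(** The half-edge (v, u) has only three neighbours, so that all three are outside X and
    in different components.  Another half-edge at v outside X would connect the
    two copies of v. *)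
Let X_half v u : e v u -> inr (v, u) \in X -> v \in T /\ inr (u, v) \notin X.
Proof.
move=> evu Xvu; have t3 := three Xvu.
have small (c1 c2 : {set H}) :
    (forall z, z \in A -> gadget (inr (v, u)) z -> cmp z = c1 \/ cmp z = c2) -> False.
  move=> H2.
  suff s2 : [set C in O | touches gadget (inr (v, u)) C] \subset [set c1; c2].
    by have := leq_trans t3 (subset_leq_card s2); rewrite cards2; case: (_ != _).
  by apply/subsetP=> C /adj_comp[z [Az gz ->]]; rewrite !inE; case: (H2 z Az gz) => ->; rewrite eqxx ?orbT.
have nbr z : gadget (inr (v, u)) z -> [\/ z = inl (v, false), z = inl (v, true) | z = inr (u, v)].
  case: z => [[a i]|[a b]] /=.
    by move=> /andP[/eqP-> _]; case: i; [constructor 2 | constructor 1].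
  by case/and3P=> /eqP-> /eqP-> _; constructor 3.
have nS : v \notin S.
  apply/negP=> Sv; apply: (small (cmp (inr (u, v))) set0) => z + /nbr[] zE.
  - by rewrite zE AE X_copy Sv.
  - by rewrite zE AE X_copy Sv.
  - by rewrite zE; left.
split; last first.
  apply/negP=> Xuv; apply: (small (cmp (inl (v, false))) (cmp (inl (v, true)))) => z + /nbr[] zE; rewrite {}zE.
  - by left.
  - by right.
  - by rewrite AE Xuv.
rewrite inE nS; apply/forallP=> u'; apply/implyP=> evu'; apply/negPn/negP=> nX.
have Au' : inr (v, u') \in A by rewrite AE nX ?W_copy ?W_half.
apply: (small (cmp (inr (v, u'))) (cmp (inr (u, v)))) => z + /nbr[] zE; rewrite {}zE => Az.
- by left; apply: (component_step gadget_sym) => //=; rewrite eqxx evu'.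
- by left; apply: (component_step gadget_sym) => //=; rewrite eqxx evu'.
- by right.
Qed.

Let X_halfE v u : e v u -> (inr (v, u) \in X) = (v \in T).
Proof.
move=> evu; apply/idP/idP=> [/(X_half evu)[]//|].
by rewrite inE => /andP[_ /forallP/(_ u)]; rewrite evu.
Qed.

Let T_half v u : e v u -> v \in T -> u \notin T.
Proof.
move=> evu; rewrite -(X_halfE evu) => /(X_half evu)[_].
by rewrite X_halfE // e_sym.
Qed.

Let disST : [disjoint S & T].
Proof.
rewrite disjoint_subset; apply/subsetP=> v Sv; rewrite inE /= inE negb_and negbK.
by rewrite Sv.
Qed.

Let A_copy v i : (inl (v, i) \in A) = (v \notin S).
Proof. by rewrite AE X_copy W_copy andbT. Qed.

Let A_half v u : (inr (v, u) \in A) = (v \notin T) && e v u.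
Proof.
by rewrite AE W_half; have [evu|] := boolP (e v u); rewrite ?andbF // X_halfE.
Qed.

Let cardX : 2 * #|S| + \sum_(v in T) #|[set u | e v u]| <= #|X|.
Proof.
pose X1 := [set @inl (V * bool) (V * V) p | p in setX S [set: bool]].
pose X2 := [set @inr (V * bool) (V * V) p | p in [set p | (p.1 \in T) && (p.2 \in [set u | e p.1 u])]].
have c1 : #|X1| = 2 * #|S|.
  by rewrite card_imset ?cardsX ?cardsT ?card_bool 1?mulnC // => x y [].
have c2 : #|X2| = \sum_(v in T) #|[set u | e v u]|.
  rewrite -(card_sigma_pairs T (fun v => [set u | e v u])).
  by rewrite card_imset // => x y [].
have d12 : [disjoint X1 & X2].
  apply/pred0P=> z /=; apply/negbTE/negP=> /andP[/imsetP[p _ ->] /imsetP[q _]]; discriminate.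
rewrite -c1 -c2; have := cardsUI X1 X2; rewrite (disjoint_setI0 d12) cards0 addn0 => <-.
apply: subset_leq_card; apply/subsetP=> z /setUP[] /imsetP[[v u]].
  by rewrite in_setX => /andP[Sv _] ->; rewrite X_copy.
by rewrite in_set /= => /andP[Tv]; rewrite in_set => evu ->; rewrite X_halfE.
Qed.

Let U := ~: (S :|: T).
Let inU v : (v \in U) = (v \notin S) && (v \notin T).
Proof. by rewrite !in_setC in_setU negb_or. Qed.

Let U_nbr v : v \in U -> exists2 u, e v u & inr (v, u) \in A.
Proof.
rewrite inU => /andP[nS nT]; move: (nT); rewrite {1}inE nS negb_forall => /existsP[u].
by rewrite negb_imply => /andP[evu nX]; exists u => //; rewrite A_half nT.
Qed.

Let cmp_UU C v i j : C \in components gadget A -> v \in U -> inl (v, i) \in C -> inl (v, j) \in C.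
Proof.
move=> CA Uv Ci; have [-> Ai] := componentsP gadget_sym CA Ci.
have [u evu Au] := U_nbr Uv.
have Aj : inl (v, j) \in A by rewrite A_copy -(A_copy v i).
have si : component gadget A (inl (v, i)) = cmp (inr (v, u)).
  by apply: (component_step gadget_sym) => //=; rewrite eqxx.
have sj : component gadget A (inl (v, j)) = cmp (inr (v, u)).
  by apply: (component_step gadget_sym) => //=; rewrite eqxx.
rewrite si -sj; exact: component_refl.
Qed.

Let in_step C z t : C \in components gadget A -> z \in C -> t \in A -> gadget z t -> t \in C.
Proof.
move=> CA Cz At zt; have [-> Az] := componentsP gadget_sym CA Cz.
rewrite (component_step gadget_sym Az At zt); exact: component_refl.
Qed.

Let half_flip C v u : C \in components gadget A -> inr (v, u) \in C -> u \notin T -> inr (u, v) \in C.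
Proof.
move=> CA Cvu nT; have [_] := componentsP gadget_sym CA Cvu; rewrite A_half => /andP[_ evu].
by apply: (in_step CA Cvu); rewrite ?A_half /= ?nT ?eqxx //= e_sym.
Qed.

Let half_copy C v u i : C \in components gadget A -> inr (v, u) \in C -> v \in U -> inl (v, i) \in C.
Proof.
move=> CA Cvu Uv; have [_] := componentsP gadget_sym CA Cvu; rewrite A_half => /andP[_ evu].
by apply: (in_step CA Cvu); rewrite ?A_copy /= ?eqxx //; move: Uv; rewrite inU => /andP[].
Qed.

Let inT_or v : [\/ v \in S, v \in T | v \in U].
Proof.
rewrite inU; have [|_] := boolP (v \in S); first by constructor 1.
by have [|_] := boolP (v \in T); [constructor 2 | constructor 3].
Qed.

Let O_parity C : C \in O -> odd #|C|.
Proof. by rewrite inE sum1_card => /andP[]. Qed.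

(** Three kinds of odd components: copies of vertices of T, half-edges from
    S to T, and the components that contain copies of vertices of U.  The last
    ones correspond to components of G[U]. *)
Let Q1 := [set cmp (inl p) | p in setX T [set: bool]].
Let Q2 := [set cmp (inr (p.2, p.1)) | p in [set p | (p.1 \in T) && (p.2 \in [set u in S | e p.1 u])]].
Let Q3 := [set C in O | [exists v in U, inl (v, false) \in C]].

(** Any other component consists of half-edges between vertices of S, which
    come in pairs. *)
Let cover : O \subset Q1 :|: Q2 :|: Q3.
Proof.
apply/subsetP=> C CO; have := CO; rewrite inE => /andP[CA _].
rewrite !in_setU; apply/negPn; rewrite !negb_or -!andbA; apply/negP=> /and3P[nQ1 nQ2 nQ3].
have noU v i : v \in U -> inl (v, i) \notin C.
  move=> Uv; apply: contra nQ3 => Ci; rewrite inE CO; apply/exists_inP; exists v => //.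
  exact: cmp_UU Ci.
have noV v i : inl (v, i) \notin C.
  case: (inT_or v) => [Sv|Tv|]; last exact: noU.
    by apply/negP=> /(componentsP gadget_sym CA)[_]; rewrite A_copy Sv.
  apply: contra nQ1 => /(componentsP gadget_sym CA)[-> _]; apply: imset_f.
  by rewrite in_setX Tv in_setT.
have noUr v u : inr (v, u) \in C -> v \in S.
  move=> Cvu; have [_] := componentsP gadget_sym CA Cvu; rewrite A_half => /andP[nT evu].
  case: (inT_or v) => // [Tv|Uv]; first by rewrite Tv in nT.
  by have := half_copy false CA Cvu Uv; rewrite (negbTE (noV _ _)).
have noT v u : inr (v, u) \in C -> u \notin T.
  move=> Cvu; have [Cdef] := componentsP gadget_sym CA Cvu; rewrite A_half => /andP[_ evu].
  apply: contra nQ2 => Tu; rewrite Cdef; apply/imsetP; exists (u, v) => //=.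
  by rewrite in_set /= Tu in_set (noUr _ _ Cvu) e_sym.
pose s (z : H) : H := match z with inl (v, i) => inl (v, ~~ i) | inr (u, v) => inr (v, u) end.
have := O_parity CO; rewrite (@odd_card_involution _ s C).
- rewrite (_ : [set x in C | _] = set0) ?cards0 //; apply/setP=> -[[v i]|[v u]]; rewrite !inE /=.
    by rewrite (negbTE (noV _ _)).
  apply/negbTE/negP=> /andP[Cvu /eqP[uv _]]; have [_] := componentsP gadget_sym CA Cvu.
  by rewrite A_half uv e_irr andbF.
- case=> [[v i]|[v u]] Cz /=; first by rewrite (negbTE (noV _ _)) in Cz.
  exact: half_flip (noT _ _ Cz).
- by case=> [[v i]|[v u]] _ //=; rewrite negbK.
Qed.

Let cardQ1 : #|Q1| <= 2 * #|T|.
Proof.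
by apply: leq_trans (leq_imset_card _ _) _; rewrite cardsX cardsT card_bool mulnC.
Qed.

Let cardQ2 : #|Q2| <= \sum_(v in T) degin S v.
Proof. rewrite -(card_sigma_pairs T (fun v => [set u in S | e v u])); exact: leq_imset_card. Qed.

(** Swap the two copies of each vertex and the two halves of each edge, where
    possible: the fixed points in a component are the half-edges towards T, so
    that its size has the parity of the number of edges to T. *)
Let cardQ3 : #|Q3| <= #|odd_comps e U (degin T)|.
Proof.
pose g v := cmp (inl (v, false)).
have gE : {in U &, forall v u, e v u -> g v = g u}.
  move=> v u Uv Uu evu; move: (Uv) (Uu); rewrite !inU => /andP[vS vT] /andP[uS uT].
  have s1 : g v = cmp (inr (v, u)).
    by apply: (component_step gadget_sym) => //=; rewrite ?A_copy ?A_half ?vT ?eqxx.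
  have s2 : g u = cmp (inr (u, v)).
    by apply: (component_step gadget_sym) => //=; rewrite ?A_copy ?A_half ?uT ?eqxx // e_sym.
  rewrite s1 s2; apply: (component_step gadget_sym) => //=; rewrite ?A_half ?vT ?uT ?eqxx // e_sym //.
apply: leq_trans (odd_labels_leq e_sym (f := g) (A := U) (degin T) gE).
apply: subset_leq_card; apply/subsetP=> C; rewrite inE => /andP[CO /exists_inP[v0 Uv0 Cv0]].
have := CO; rewrite inE => /andP[CA _]; rewrite inE.
pose B := [set v in U | inl (v, false) \in C].
have -> : \sum_(v in U | g v == C) degin T v = \sum_(v in B) degin T v.
  apply: eq_bigl => v; rewrite [in RHS]in_set; have [Uv /=|//] := boolP (v \in U).
  by apply: (mem_component gadget_sym CA); rewrite A_copy; move: Uv; rewrite inU => /andP[].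
have single z : z \in C -> (forall t, t \in A -> gadget z t = false) -> z = inl (v0, false).
  move=> Cz iz; have [Cdef Az] := componentsP gadget_sym CA Cz.
  by move: Cv0; rewrite Cdef (component_isolated gadget_sym Az iz) inE => /eqP.
have v0T : v0 \notin T by move: Uv0; rewrite inU => /andP[].
have noT v i : inl (v, i) \in C -> v \in U.
  move=> Cvi; have [Cdef] := componentsP gadget_sym CA Cvi; rewrite A_copy inU => -> /=.
  apply/negP=> Tv; suff [vv0 _] : inl (v, i) = inl (v0, false) :> H by rewrite -vv0 Tv in v0T.
  apply: single Cvi _ => -[[a j]|[a b]] //=; rewrite A_half => /andP[aT _].
  by apply/negbTE/negP=> /andP[/eqP va _]; rewrite -va Tv in aT.
have noST v u : inr (v, u) \in C -> u \in T -> v \in U.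
  move=> Cvu Tu; have [_] := componentsP gadget_sym CA Cvu; rewrite A_half => /andP[vT evu].
  rewrite inU vT andbT; apply/negP=> Sv; suff: inr (v, u) = inl (v0, false) :> H by [].
  apply: single Cvu _ => -[[a j]|[a b]] /=.
    by rewrite A_copy; have [->|//] := eqVneq a v; rewrite Sv.
  rewrite A_half => /andP[aT _]; apply/negbTE/negP=> /and3P[_ /eqP ua _].
  by rewrite -ua Tu in aT.
pose s (z : H) : H := match z with
  | inl (v, i) => inl (v, ~~ i) | inr (v, u) => if u \in T then inr (v, u) else inr (u, v) end.
have := O_parity CO; rewrite (@odd_card_involution _ s C).
- rewrite -(card_sigma_pairs B (fun v => [set y in T | e v y])).
  rewrite -(card_imset _ (@inr_inj (V * bool) (V * V))); congr (odd #|pred_of_set _|).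
  apply/setP=> -[[v i]|[v u]].
    rewrite inE; have -> : s (inl (v, i)) == inl (v, i) = false by case: (i); apply/eqP.
    by rewrite andbF; apply/esym/imsetP=> -[p _].
  rewrite mem_imset; last exact: inr_inj.
  rewrite [in RHS]in_set /= [v \in B]in_set [in RHS]in_set [in LHS]in_set.
  apply/andP/andP=> [[Cvu su]|[/andP[Uv Cv] /andP[Tu evu]]].
    have [_] := componentsP gadget_sym CA Cvu; rewrite A_half => /andP[vT evu].
    have Tu : u \in T.
      by move: su; rewrite /s; case: ifP => // _ /eqP[uv _]; rewrite uv e_irr in evu.
    have Uv := noST _ _ Cvu Tu.
    by rewrite Uv evu Tu; split=> //; apply: (half_copy false CA Cvu Uv).
  rewrite /s Tu eqxx; split=> //; apply: (in_step CA Cv).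
    by rewrite A_half evu (T_half _ Tu) // e_sym.
  by rewrite /= eqxx.
- case=> [[v i]|[v u]] Cz /=; first exact: cmp_UU (noT _ _ Cz) Cz.
  by case: ifP => // /negbT uT; apply: half_flip Cz uT.
- case=> [[v i]|[v u]] Cz; first by rewrite /= negbK.
  have [_] := componentsP gadget_sym CA Cz; rewrite A_half => /andP[/negbTE vT _].
  by rewrite /s; have [Tu|/negbTE uT] := boolP (u \in T); rewrite ?Tu ?uT ?vT.
Qed.

Lemma barrier_from_gadget : barrier S T.
Proof.
rewrite /barrier disST.
have cO : #|O| <= 2 * #|T| + \sum_(v in T) degin S v + #|odd_comps e U (degin T)|.
  apply: leq_trans (subset_leq_card cover) _.
  apply: leq_trans (leq_card_setU _ _) _; apply: leq_add cardQ3.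
  by apply: leq_trans (leq_card_setU _ _) _; apply: leq_add cardQ1 cardQ2.
have dE : \sum_(v in T) #|[set u | e v u]| =
          \sum_(v in T) degin (~: S) v + \sum_(v in T) degin S v.
  rewrite -big_split /=; apply: eq_bigr => v _.
  rewrite -(cardsID S [set u | e v u]) addnC; congr (_ + _); apply: eq_card => u; rewrite !in_set //.
  by rewrite andbC.
have := leq_trans (leq_ltn_trans cardX defX) cO; rewrite dE.
by rewrite addnA [X in _ < X -> _]addnAC ltn_add2r.
Qed.

End FromGadget.

Theorem two_factor_or_barrier : (exists f, two_factor f) \/ exists S T, barrier S T.
Proof.
have [M [X [mM sX defX]]] := tutte_berge gadget_sym gadget_irr gverts.
have [M0|] := eqVneq (missed gverts M) set0.
  by left; apply: gadget_two_factor mM M0.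
rewrite -card_gt0 => M0; right.
pose P (Y : {set H}) := (Y \subset gverts) && (#|Y| < #|odd_comps gadget (gverts :\: Y) (fun=> 1)|).
have PX : P X.
  by rewrite /P sX; apply: leq_trans defX; rewrite -add1n leq_add2r.
case: (arg_minnP (fun Y : {set H} => #|Y|) PX) => Y /andP[sY dY] minY.
eexists; eexists; apply: (barrier_from_gadget sY dY) => Z sZ ltZ.
by rewrite leqNgt; apply/negP=> dZ; move: ltZ; rewrite ltnNge minY // /P sZ.
Qed.

End TwoFactorBarrier.

(** * Minimal barriers *)

Section TidyBarrier.
Variables (V : finType) (e : rel V).
Hypotheses (e_sym : symmetric e) (e_irr : irreflexive e).
Implicit Types S T U : {set V}.

Lemma sum_degin_sym (A B : {set V}) : \sum_(y in A) degin e B y = \sum_(x in B) degin e A x.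
Proof.
have E (D : {set V}) x : degin e D x = \sum_(y in D) e x y.
  rewrite /degin /nbr -sum1_card big_set /= big_mkcondr /=; apply: eq_bigr => y _.
  by case: (e x y).
rewrite (eq_bigr _ (fun y _ => E B y)) (eq_bigr _ (fun y _ => E A y)) exchange_big /=.
by apply: eq_bigr => x _; apply: eq_bigr => y _; rewrite e_sym.
Qed.

Lemma degin_gt0 (B : {set V}) x : (0 < degin e B x) = [exists y in B, e x y].
Proof.
rewrite card_gt0; apply/set0Pn/exists_inP=> [[y]|[y By exy]].
  by rewrite inE => /andP[By exy]; exists y.
by exists y; rewrite inE By.
Qed.

Lemma deginU (A B : {set V}) x : [disjoint A & B] ->
  degin e (A :|: B) x = degin e A x + degin e B x.
Proof.
move=> dAB; rewrite /degin /nbr -cardsUI [X in _ = _ + #|pred_of_set X|](_ : _ = set0).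
  rewrite cards0 addn0; congr #|pred_of_set _|; apply/setP=> y; rewrite !inE.
  by rewrite andb_orl.
apply/setP=> y; rewrite !inE; apply/negbTE/negP=> /andP[/andP[Ay _] /andP[By _]].
by have /pred0P/(_ y) := dAB; rewrite /= Ay By.
Qed.

Section Minimal.
Variables (S T : {set V}).
Hypotheses (bST : barrier e S T) (minT : forall T', T' \proper T -> ~~ barrier e S T').
Let U := ~: (S :|: T).
Let O := odd_comps e U (degin e T).

Let disST : [disjoint S & T]. Proof. by case/andP: bST. Qed.
Let setCS : ~: S = T :|: U.
Proof.
apply/setP=> x; rewrite !inE; have [Sx|nSx] /= := boolP (x \in S); last by case: (x \in T).
by rewrite orbF (disjointFr disST Sx).
Qed.
Let disTU : [disjoint T & U].
Proof. by apply/pred0P=> x /=; rewrite !inE; case: (x \in T); rewrite ?orbT. Qed.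

(** Moving y from T to U gives no barrier.  The inequality so obtained leaves
    room only for degin T y + degin U y <= number of odd components at y + 1, and
    equality is excluded since the component containing y would then be odd. *)
Let key y : y \in T -> degin e T y + degin e U y <= #|[set C in O | touches e y C]|.
Proof.
move=> Ty; set J := [set C in O | _]; pose T' := T :\ y.
have cT : #|T| = #|T'|.+1 by rewrite (cardsD1 y T) Ty.
have sT : T' \proper T by rewrite properD1.
have nUy : y \notin U by rewrite !inE Ty orbT.
have nSy : y \notin S by rewrite (disjointFl disST Ty).
have UE : y |: U = ~: (S :|: T').
  by apply/setP=> z; rewrite !inE; have [->|] := eqVneq z y; rewrite ?orbF ?(negbTE nSy).
pose N := [set z in U | touches e y (component e U z)].
have yN : y \notin N by rewrite inE (negbTE nUy).
have touch z : e y z -> touches e y (component e U z).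
  by move=> eyz; apply/exists_inP; exists z => //; apply: component_refl.
have eqw z : degin e T z = degin e T' z + e y z.
  have -> : T = T' :|: [set y] by rewrite setUC setD1K.
  rewrite deginU; last by rewrite disjoint_sym disjoints1 !inE eqxx.
  congr (_ + _); rewrite /degin /nbr.
  have [eyz|neyz] := boolP (e y z).
    rewrite (_ : [set _ in _ | _] = [set y]) ?cards1 //; apply/setP=> u; rewrite !inE.
    by case: eqP => [->|//]; rewrite e_sym eyz.
  apply/eqP; rewrite cards_eq0; apply/eqP/setP=> u; rewrite !inE.
  by case: eqP => [->|//]; rewrite e_sym (negbTE neyz).
have := @odd_comps_add _ e e_sym U (degin e T) (degin e T') y nUy.
rewrite -/O -/J -/N UE big_setU1 //= => H.
have {H}/H : {in U, forall z, ~~ touches e y (component e U z) -> degin e T' z = degin e T z}.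
  move=> z Uz; apply: contraNeq; rewrite eqw; case: (boolP (e y z)) => [/touch //|_].
  by rewrite addn0 eqxx.
have par : odd (degin e T' y + \sum_(z in N) degin e T' z) = odd (degin e T y + degin e U y + #|J|).
  have -> : degin e U y = \sum_(z in N) e y z.
    rewrite /degin /nbr -sum1_card big_set [RHS]big_set /= !big_mkcondr /=.
    apply: eq_bigr => z _; case: (boolP (e y z)) => [/touch -> //|_]; by case: ifP.
  have := odd_sum_components e_sym U (degin e T) (touches e y); rewrite -/N -/J => oJ.
  have : \sum_(z in N) degin e T z = \sum_(z in N) degin e T' z + \sum_(z in N) e y z.
    by rewrite -big_split; apply: eq_bigr => z _; apply: eqw.
  have := eqw y; rewrite e_irr addn0 => <- E; rewrite !oddD -oJ E oddD.
  by case: (odd (degin e T y)); case: (odd (\sum_(z in N) e y z)); case: (odd _).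
have dy : degin e (~: S) y = degin e T y + degin e U y by rewrite setCS deginU.
have := minT sT; rewrite /barrier.
have -> /= : [disjoint S & T'].
  exact: disjointWr (subsetDl _ _) disST.
have := bST; rewrite /barrier -/U -/O => /andP[_].
rewrite (big_setD1 y Ty) /= -/T' dy cT par.
set a := \sum_(_ in _) _; set b := #|odd_comps _ _ _|.
move: (degin e T y) (degin e U y) #|S| #|T'| #|O| #|J| a b => dT dU s t o j a b.
rewrite -leqNgt => h1 h2; rewrite leqNgt => h3; apply/negP=> h4; move: h3.
have [->|ne] := eqVneq (dT + dU) j.+1; first by rewrite oddD /= ?addNb; move: h1 h2 h4; case: (odd j) => /=; clear; lia.
by move: ne h1 h2 h4; case: (odd _) => /=; clear; lia.
Qed.

(** There are at most as many odd components at y as neighbours of y in U, so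
    equality holds throughout in the previous bound. *)
Let nbrs_of_T y : y \in T ->
  [/\ degin e T y = 0,
      {in [set x in U | e y x] &, injective (component e U)}
    & {in [set x in U | e y x], forall x, component e U x \in O}].
Proof.
move=> Ty; have k := key Ty; set N := [set x in U | _].
pose C := component e U @: N.
have sJ : [set C in O | touches e y C] \subset C.
  apply/subsetP=> D; rewrite !inE => /andP[/andP[CD _] /exists_inP[z Dz eyz]].
  have [-> Uz] := componentsP e_sym CD Dz; apply: imset_f; by rewrite inE Uz.
have le1 := subset_leq_card sJ; have le2 : #|C| <= #|N| := leq_imset_card _ _.
have dN : degin e U y = #|N| by [].
rewrite dN in k; move: k le1 le2; set j := #|[set _ in _ | _]| => k le1 le2.
have T0 : degin e T y = 0 by move: k le1 le2; clear; move: (degin e T y) #|N| #|C| => a b c; lia.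
have cC : #|C| = #|N| by apply/eqP; rewrite eqn_leq le2 (leq_trans _ le1) // (leq_trans _ k) // leq_addl.
have JC : [set C in O | touches e y C] = C.
  by apply/eqP; rewrite eqEcard sJ cC (leq_trans _ k) // leq_addl.
split=> //; first exact/imset_injP/eqP.
move=> x Nx; have : component e U x \in C by apply: imset_f.
by rewrite -JC inE => /andP[].
Qed.

Lemma minimal_barrier_tidy :
  [/\ {in T &, forall y z, ~~ e y z},
      {in T, forall y, {in U &, forall x z, e y x -> e y z ->
         component e U x = component e U z -> x = z}},
      {in T, forall y, {in U, forall x, e y x -> component e U x \in O}}
    & #|S| + \sum_(C in O) (\sum_(x in C) degin e T x)./2 < #|T|].
Proof.
have T0 y z : y \in T -> z \in T -> ~~ e y z.
  move=> Ty Tz; have [T0 _ _] := nbrs_of_T Ty; apply/negP=> eyz.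
  have := degin_gt0 T y; rewrite T0 => /esym/negbT/exists_inP[]; by exists z.
have TO y x : y \in T -> x \in U -> e y x -> component e U x \in O.
  by move=> Ty Ux eyx; have [_ _] := nbrs_of_T Ty; apply; rewrite inE Ux.
split=> [y z Ty Tz|y Ty x z Ux Uz eyx eyz|y Ty x Ux eyx|]; [exact: T0| |exact: (TO y)|].
  by have [_ inj _] := nbrs_of_T Ty; apply: inj; rewrite inE ?Ux ?Uz.
have := bST; rewrite /barrier -/U -/O => /andP[_].
rewrite (eq_bigr (degin e U)) => [|y Ty]; last first.
  by have [T0y _ _] := nbrs_of_T Ty; rewrite setCS deginU // T0y.
rewrite sum_degin_sym (sum_components e_sym) (bigID (mem O)) /=.
rewrite [X in _ + (_ + X)]big1 => [|C /andP[CU nO]]; last first.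
  apply: big1 => x Cx; have [CE Ux] := componentsP e_sym CU Cx.
  apply/eqP; rewrite -leqn0 leqNgt degin_gt0; apply: contra nO => /exists_inP[y Ty exy].
  by rewrite CE; apply: (TO y x Ty Ux); rewrite e_sym.
rewrite addn0 (eq_bigl (fun C => C \in O)) => [|C]; last first.
  by rewrite andbC; have [|//] := boolP (C \in O); rewrite inE => /andP[->].
have -> : \sum_(C in O) \sum_(x in C) degin e T x =
          \sum_(C in O) ((\sum_(x in C) degin e T x)./2 * 2 + 1).
  apply: eq_bigr => C; rewrite inE => /andP[_ oC].
  by rewrite -[LHS]odd_double_half oC addnC muln2.
rewrite big_split /= -big_distrl /= sum1_card.
move: (\sum_(i in O) _) => k; move: #|S| #|T| #|O| => s t o; clear; lia.
Qed.
End Minimal.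
(** The last inequality is that of the barrier: by the other properties, the degrees of
    the vertices of T in G - S count the edges between T and the odd components. *)
Theorem tidy_barrier S T0 : barrier e S T0 -> exists T (U := ~: (S :|: T)),
  [/\ [disjoint S & T],
      {in T &, forall y z, ~~ e y z},
      {in T, forall y, {in U &, forall x z, e y x -> e y z ->
         component e U x = component e U z -> x = z}},
      {in T, forall y, {in U, forall x, e y x ->
         component e U x \in odd_comps e U (degin e T)}}
    & #|S| + \sum_(C in odd_comps e U (degin e T)) (\sum_(x in C) degin e T x)./2 < #|T|].
Proof.
move=> b0; case: (arg_minnP (P := barrier e S) (fun T : {set V} => #|T|) b0) => T bT minT.
exists T; have [|P1 P2 P3 P4] := @minimal_barrier_tidy S T bT.
  by move=> T' /proper_card; rewrite ltnNge; apply: contra => /minT.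
by split=> //; case/andP: bT.
Qed.

End TidyBarrier.

(** * Induced paths *)

Section InducedPaths.
Variables (V : finType) (e : rel V).
Hypothesis e_sym : symmetric e.
Implicit Types (s p q : seq V).

(** A list of distinct vertices that induces a path, in this order. *)
Fixpoint ipath s : bool :=
  if s is x :: s' then
    [&& x \notin s', ipath s' & if s' is y :: s'' then e x y && ~~ has (e x) s'' else true]
  else true.

Lemma ipath_consP x s :
  reflect [/\ ipath s, x \notin s & {in s, forall z, e x z = (z == head z s)}]
          (ipath (x :: s)).
Proof.
apply: (iffP and3P) => [[xs ps H]|[ps xs xe]]; split=> //.
  case: s xs ps H => [|y s] xs ps // /andP[exy /hasPn nxs] z.
  by rewrite inE /=; have [->//|zy /= sz] := eqVneq z y; apply/negbTE/nxs.
case: s xs xe ps => [|y s] // xs xe /and3P[ys _ _].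
rewrite xe ?mem_head ?eqxx //=; apply/hasPn=> z sz; rewrite xe ?inE ?sz ?orbT //=.
by apply: contraNneq ys => <-.
Qed.

Lemma ipath_cat s1 s2 : ipath s1 -> ipath s2 ->
    {in s1 & s2, forall u v, u != v} ->
    {in s1 & s2, forall u v, e u v = (u == last u s1) && (v == head v s2)} ->
  ipath (s1 ++ s2).
Proof.
elim: s1 => // x s1 IH /ipath_consP[p1 xs1 xe] p2 ne ae; rewrite cat_cons; apply/ipath_consP; split.
- apply: IH => // u v s1u s2v; first by apply: ne; rewrite // inE s1u orbT.
  rewrite ae ?inE ?s1u ?orbT //=; congr (_ && _).
  by case: s1 s1u {xs1 xe p1 ne ae}.
- rewrite mem_cat negb_or xs1; apply/negP=> s2x.
  by have := ne x x (mem_head _ _) s2x; rewrite eqxx.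
move=> z; rewrite mem_cat; case: s1 p1 xs1 xe ne ae {IH} => [|y s1] p1 xs1 xe ne ae /=.
  by move=> s2z; rewrite ae ?mem_head //= eqxx.
move=> /orP[/xe //|s2z]; rewrite ae ?mem_head //= (negbTE (_ : x != last y s1)) /=.
  by apply/esym/negbTE; rewrite eq_sym; apply: ne => //; rewrite !inE eqxx orbT.
by apply: contraNneq xs1 => ->; apply: mem_last.
Qed.

Lemma ipath_catl s1 s2 : ipath (s1 ++ s2) -> ipath s1.
Proof.
elim: s1 => // x s1 IH; rewrite cat_cons => /ipath_consP[/IH p1 + xe].
rewrite mem_cat negb_or => /andP[xs1 _]; apply/ipath_consP; split=> // z s1z.
rewrite xe ?mem_cat ?s1z //; by case: s1 s1z {IH p1 xs1 xe}.
Qed.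

Lemma ipath_catr s1 s2 : ipath (s1 ++ s2) -> ipath s2.
Proof. by elim: s1 => // x s1 IH; rewrite cat_cons => /ipath_consP[/IH]. Qed.

Lemma ipath_rcons s y : ipath s -> y \notin s ->
  {in s, forall z, e z y = (z == last z s)} -> ipath (rcons s y).
Proof.
move=> ps ys ye; rewrite -cats1; apply: ipath_cat => //.
  by move=> u v su; rewrite inE => /eqP->; apply: contraNneq ys => <-.
by move=> u v su; rewrite inE => /eqP->; rewrite /= eqxx andbT ye.
Qed.

Lemma ipath_rev s : ipath s -> ipath (rev s).
Proof.
elim: s => // x s IH /ipath_consP[ps xs xe]; rewrite rev_cons; apply: ipath_rcons.
- exact: IH.
- by rewrite mem_rev.
move=> z; rewrite mem_rev => sz; rewrite e_sym xe //.
by case: s sz {IH ps xs xe} => // y s _; rewrite rev_cons last_rcons.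
Qed.

Lemma ipath_uniq s : ipath s -> uniq s.
Proof. by elim: s => //= x s IH /and3P[-> /IH]. Qed.

Lemma ipath_nth x0 s i j : ipath s -> i < j -> j < size s ->
  e (nth x0 s i) (nth x0 s j) = (i.+1 == j).
Proof.
elim: s i j => // x s IH [|i] [|j] // /ipath_consP[ps xs xe] ij js; last exact: IH.
rewrite [LHS]/= xe ?mem_nth //; have := nth_uniq x0 (i := j) (j := 0) js _ (ipath_uniq ps).
by case: s js {xs xe IH ps} => // y s _ /(_ isT); rewrite /= => ->; rewrite [RHS]eq_sym.
Qed.

Lemma has_split_last (P : pred V) s : has P s ->
  exists s1 x s2, [/\ s = s1 ++ x :: s2, P x & ~~ has P s2].
Proof.
elim: s => //= x s IH; have [/IH[s1 [y [s2 [-> Py nP]]]] _|nP] := boolP (has P s).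
  by exists (x :: s1), y, s2.
by rewrite orbF => Px; exists [::], x, s.
Qed.

(** Prepend x to an induced path from its successor; if x has further neighbours on
    that path, continue from the last of them. *)
Lemma ipath_connect (A : {set V}) x y : x \in A -> connect (restr e A) x y ->
  exists s, [/\ ipath (x :: s), last x s = y & {subset x :: s <= A}].
Proof.
move=> Ax /connectP[p + ->]; elim: p x Ax => [|z p IH] x Ax.
  by exists [::]; split=> // z; rewrite inE => /eqP->.
case/andP=> /and3P[_ Az exz] /(IH _ Az)[s [ps lst sA]].
rewrite [last x _]/= -lst -[last z s]/(last x (z :: s)).
have [xs|xs] := boolP (x \in z :: s).
  have [s1 [s2 E]] : exists s1 s2, z :: s = s1 ++ x :: s2.
    by case/splitPr: xs => s1 s2; exists s1, s2.
  move: ps sA; rewrite E => /ipath_catr ps sA; exists s2; split=> //.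
    by rewrite last_cat.
  by move=> u su; apply: sA; rewrite mem_cat su orbT.
have [|s1 [w [s2 [E exw nP]]]] := @has_split_last (e x) (z :: s); first by rewrite /= exz.
move: ps sA xs; rewrite E => /ipath_catr ps sA; rewrite mem_cat negb_or => /andP[_ xs].
exists (w :: s2); split; rewrite ?last_cat //.
  apply/ipath_consP; split=> // u; rewrite inE /=; have [->|_ /= s2u] := eqVneq u w.
    by rewrite exw.
  exact/negbTE/(hasPn nP).
by move=> u; rewrite inE => /predU1P[->|su] //; apply: sA; rewrite mem_cat su orbT.
Qed.

(** Cutting a connecting path at its first vertex with property P ensures that
    none of its inner vertices has this property. *)
Lemma ipath_to_first (A : {set V}) (P : pred V) x y : x \in A ->
    connect (restr e A) x y -> y != x -> P y ->
  exists q b, [/\ ipath (x :: rcons q b), {subset x :: rcons q b <= A}, P b & ~~ has P q].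
Proof.
move=> Ax cxy yx Py; have [s [ps lst sA]] := ipath_connect Ax cxy.
have hs : has P s.
  apply/hasP; exists y => //; rewrite -lst; case: s lst {ps sA} => [xy|z s _] /=.
    by rewrite -xy eqxx in yx.
  exact: mem_last.
case: (split_find hs) ps sA => b q s2 Pb nP ps sA; exists q, b; split=> //.
  by move: ps; rewrite -cat_cons => /ipath_catl.
by move=> u su; apply: sA; rewrite -cat_cons mem_cat su.
Qed.

End InducedPaths.

(** * Induced paths across a tidy barrier *)

Section PathsThroughBarrier.
Variables (V : finType) (e : rel V) (T U : {set V}).
Hypothesis e_sym : symmetric e.
Hypotheses (disTU : [disjoint T & U]) (indep : {in T &, forall y z, ~~ e y z}).
Hypothesis one_edge : {in T, forall y, {in U &, forall x z, e y x -> e y z ->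
  component e U x = component e U z -> x = z}}.
Implicit Types (s q r : seq V) (D : {set V}) (x y z b : V).

Local Notation NT := (nbr e T).

Definition attach D : {set V} := [set x in D | NT x != set0].
(** With e(D,T) = 2k + 1 edges, D has at least k + 2 attached vertices.  This
    bounds the number of neighbours in T of one or two of them. *)
Definition spread D : bool :=
  [&& D \in components e U, odd (\sum_(x in D) #|NT x|)
    & (\sum_(x in D) #|NT x|)./2 + 2 <= #|attach D|].

(** The isolated vertices are found in T, where independence is granted. *)
Definition path_with_isolated n k : Prop := exists s (I : {set V}),
  [/\ ipath e s, n <= size s, I \subset T, k <= #|I|
    & {in I & s, forall y z, y != z /\ ~~ e y z}].

(** The vertices of T that a path meets or sees are collected in a set K, of
    which only the size matters. *)
Definition covered (K : {set V}) z := {in T, forall y, y = z \/ e z y -> y \in K}.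

Lemma path_with_isolatedI n k s (K : {set V}) :
  ipath e s -> n <= size s -> {in s, forall z, covered K z} -> k + #|K| <= #|T| ->
  path_with_isolated n k.
Proof.
move=> ps ns cK leK; exists s, (T :\: K); split=> //; first exact: subsetDl.
  have := cardsID K T; have := subset_leq_card (subsetIr T K).
  by move: leK; move: #|T| #|K| #|T :&: K| #|T :\: K| => a b c d; clear; lia.
move=> y z; rewrite inE => /andP[nKy Ty] sz.
have nc := cK z sz y Ty; split; first by apply: contra nKy => /eqP ?; apply: nc; left.
by apply: contra nKy => eyz; apply: nc; right; rewrite e_sym.
Qed.

(** Every attached vertex outside B contributes at least one edge. *)
Lemma attach_sum D (B : {set V}) : B \subset attach D ->
  \sum_(x in B) #|NT x| + #|attach D| <= \sum_(x in D) #|NT x| + #|B|.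
Proof.
move=> sB; have sD : attach D \subset D by apply/subsetP=> x; rewrite inE => /andP[].
rewrite [X in _ <= X + _](big_setID (attach D)) /= (setIidPr sD).
rewrite [X in _ <= X + _ + _](big_setID B) /= (setIidPr sB).
have : #|attach D :\: B| <= \sum_(x in attach D :\: B) #|NT x|.
  rewrite -sum1_card; apply: leq_sum => x; rewrite !inE => /andP[_ /andP[_]].
  by rewrite card_gt0.
have := cardsID B (attach D); rewrite (setIidPr sB).
move: #|B| #|attach D| #|attach D :\: B| => b a c.
move: (\sum_(x in B) _) (\sum_(x in attach D :\: B) _) (\sum_(x in D :\: _) _) => u v w; clear; lia.
Qed.

Lemma spread_attach1 D b : spread D -> b \in attach D ->
  #|NT b| <= (\sum_(x in D) #|NT x|)./2.
Proof.
case/and3P=> _ oD; have := odd_double_half (\sum_(x in D) #|NT x|); rewrite oD => hD le ab.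
have := @attach_sum D [set b]; rewrite sub1set big_set1 cards1 => /(_ ab).
move: hD le; move: (\sum_(x in D) _) #|attach D| #|NT b| => s a c; clear; lia.
Qed.

Lemma spread_attach2 D b c : spread D -> b \in attach D -> c \in attach D -> b != c ->
  #|NT b| + #|NT c| <= (\sum_(x in D) #|NT x|)./2.+1.
Proof.
case/and3P=> _ oD; have := odd_double_half (\sum_(x in D) #|NT x|); rewrite oD => hD le ab ac bc.
have := @attach_sum D [set b; c]; rewrite subUset !sub1set ab ac => /(_ isT).
rewrite big_setU1 ?inE //= big_set1 cards2 bc.
move: hD le; move: (\sum_(x in D) _) #|attach D| #|NT b| #|NT c| => s a n m; clear; lia.
Qed.

Lemma spread_attach_gt2 D : spread D -> 2 < #|attach D|.
Proof.
case/and3P=> _ oD; have := odd_double_half (\sum_(x in D) #|NT x|); rewrite oD.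
have := @attach_sum D set0 (sub0set _); rewrite big_set0 cards0.
move: (\sum_(x in D) _) #|attach D| => s a; clear; lia.
Qed.

Lemma spread_half_gt0 D : spread D -> 0 < (\sum_(x in D) #|NT x|)./2.
Proof.
move=> gD; have := spread_attach_gt2 gD.
have := @attach_sum D set0 (sub0set _); rewrite big_set0 cards0.
move: (\sum_(x in D) _) #|attach D| => s a; clear; lia.
Qed.

Lemma ipath_in_component x s : ipath e (x :: s) -> {subset x :: s <= U} ->
  {subset x :: s <= component e U x}.
Proof.
elim: s x => [|z s IH] x /ipath_consP[ps _ xe] sU u.
  by rewrite inE => /eqP->; apply: component_refl.
rewrite inE => /predU1P[->|su]; first exact: component_refl.
have exz : e x z by rewrite xe ?mem_head //= eqxx.
have [Ux Uz] : x \in U /\ z \in U by split; apply: sU; rewrite !inE eqxx ?orbT.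
rewrite (component_step e_sym Ux Uz exz); apply: IH su => // v sv.
by apply: sU; rewrite inE sv orbT.
Qed.

(** A path in D from x to another attached vertex b whose inner vertices are not
    attached, except possibly b0.  Since D has three attached vertices, b can be
    chosen different from b0; taking b0 = x excludes no vertex. *)
Lemma leg D x b0 : spread D -> x \in D -> exists q b,
  [/\ ipath e (x :: rcons q b), {subset x :: rcons q b <= D}, b \in attach D,
      b != b0 & {in q, forall z, NT z != set0 -> z = b0}].
Proof.
move=> gD Dx; have [CD _ _] := and3P gD; have [DE Ux] := componentsP e_sym CD Dx.
have : 0 < #|attach D :\ x :\ b0|.
  have := cardsD1 x (attach D); have := cardsD1 b0 (attach D :\ x).
  have := spread_attach_gt2 gD.
  move: #|attach D| #|attach D :\ x| #|attach D :\ x :\ b0| => a1 a2 a3.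
  by case: (_ \in _); case: (_ \in _) => /=; clear; lia.
rewrite card_gt0 => /set0Pn[y]; rewrite !inE => /and3P[yb0 yx /andP[Dy ay]].
pose P z := (NT z != set0) && (z != b0).
have cxy : connect (restr e U) x y by move: Dy; rewrite DE inE.
have [|q [b [pq sU /andP[ab bb0] nP]]] := @ipath_to_first _ _ U P x y Ux cxy yx.
  by rewrite /P ay.
have sD := ipath_in_component pq sU; rewrite -DE in sD.
exists q, b; split=> //; first by rewrite inE sD // inE mem_rcons mem_head orbT.
move=> z qz az; have := hasPn nP z qz; rewrite /P az /= negbK => /eqP//.
Qed.

Lemma T_notU y z : y \in T -> z \in U -> y != z.
Proof. by move=> Ty Uz; apply: contraTneq Ty => ->; rewrite (disjointFl disTU). Qed.

Lemma one_edge_eq D y x z : D \in components e U -> y \in T -> x \in D -> e y x -> z \in D ->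
  e y z = (z == x).
Proof.
move=> CD Ty Dx eyx Dz; have [DE Uz] := componentsP e_sym CD Dz; have [DEx Ux] := componentsP e_sym CD Dx.
by apply/idP/eqP=> [eyz|->//]; apply: (one_edge Ty) => //; rewrite -DE -DEx.
Qed.

Lemma components_apart D1 D2 x z : D1 \in components e U -> D2 \in components e U -> D1 != D2 ->
  x \in D1 -> z \in D2 -> x != z /\ ~~ e x z.
Proof.
move=> C1 C2 ne Dx Dz; have [E1 Ux] := componentsP e_sym C1 Dx; have [E2 Uz] := componentsP e_sym C2 Dz.
split; apply: contra ne; first by move/eqP=> xz; rewrite E1 E2 xz.
by move=> /(component_step e_sym Ux Uz) cE; rewrite E1 E2 cE.
Qed.

Section Joined.
Variables (D1 D2 : {set V}) (y1 x1 x2 : V) (r1 r2 : seq V).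
Hypotheses (C1 : D1 \in components e U) (C2 : D2 \in components e U) (ne : D1 != D2).
Hypotheses (Ty1 : y1 \in T) (e1 : e y1 x1) (e2 : e y1 x2).
Hypotheses (p1 : ipath e (x1 :: r1)) (p2 : ipath e (x2 :: r2)).
Hypotheses (s1 : {subset x1 :: r1 <= D1}) (s2 : {subset x2 :: r2 <= D2}).

Let inU1 z : z \in x1 :: r1 -> z \in U. Proof. by move/s1/(componentsP e_sym C1)=> []. Qed.
Let inU2 z : z \in x2 :: r2 -> z \in U. Proof. by move/s2/(componentsP e_sym C2)=> []. Qed.

Lemma ipath_join : ipath e (rev (x1 :: r1) ++ y1 :: x2 :: r2).
Proof.
have p2' : ipath e (y1 :: x2 :: r2).
  apply/ipath_consP; split=> //.
    by apply/negP=> /inU2 /(T_notU Ty1); rewrite eqxx.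
  by move=> z /s2 Dz; apply: (one_edge_eq C2) => //; apply/s2/mem_head.
apply: ipath_cat => //; first exact: ipath_rev.
  move=> u v; rewrite mem_rev [v \in _]inE => su /predU1P[->|sv].
    by rewrite eq_sym T_notU // inU1.
  by have [] := components_apart C1 C2 ne (s1 su) (s2 sv).
move=> u v; rewrite mem_rev [v \in _]inE rev_cons last_rcons /= => su /predU1P[->|sv].
  by rewrite eqxx andbT e_sym; apply: (one_edge_eq C1) => //; [apply/s1/mem_head | apply: s1].
have [_ /negbTE->] := components_apart C1 C2 ne (s1 su) (s2 sv).
by rewrite [v == _]eq_sym (negbTE (T_notU Ty1 (inU2 sv))) andbF.
Qed.

Lemma ipath_join_rcons y2 : y2 \in T -> y2 != y1 -> e y2 (last x2 r2) ->
  {in x1 :: r1, forall z, ~~ e y2 z} ->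
  ipath e (rev (x1 :: r1) ++ y1 :: x2 :: rcons r2 y2).
Proof.
move=> Ty2 ny e2l n1; rewrite -!rcons_cons -rcons_cat; apply: ipath_rcons ipath_join _ _.
  rewrite mem_cat mem_rev negb_or [_ \in y1 :: _]in_cons negb_or ny /=; apply/andP; split.
    by apply/negP=> /inU1 /(T_notU Ty2); rewrite eqxx.
  by apply/negP=> /inU2 /(T_notU Ty2); rewrite eqxx.
have l2 : last x2 r2 \in x2 :: r2 by apply: mem_last.
move=> z; rewrite last_cat /= mem_cat mem_rev inE => /or3P[sz|/eqP->|sz].
- rewrite e_sym (negbTE (n1 z sz)); apply/esym/negbTE.
  by have [] := components_apart C1 C2 ne (s1 sz) (s2 l2).
- by rewrite (negbTE (indep Ty1 Ty2)) (negbTE (T_notU Ty1 (inU2 l2))).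
by rewrite e_sym; apply: (one_edge_eq C2) => //; apply: s2.
Qed.

End Joined.

Lemma ipath_join_cons D q x b t y0 : D \in components e U ->
  {subset x :: rcons q b <= D} -> ipath e (rev (x :: rcons q b) ++ t) ->
  y0 \in T -> e y0 b -> y0 \notin t -> {in t, forall z, ~~ e y0 z} ->
  {in t, forall z, z != b} ->
  ipath e (y0 :: rev (x :: rcons q b) ++ t).
Proof.
move=> CD sD ps Ty0 e0 nt et tb.
have Db : b \in D by apply: sD; rewrite inE mem_rcons mem_head orbT.
have hd z : head z (rev (x :: rcons q b) ++ t) = b by rewrite rev_cons rev_rcons.
apply/ipath_consP; split=> //.
  rewrite mem_cat mem_rev negb_or nt andbT; apply/negP=> /sD /(componentsP e_sym CD)[_ Uy].
  by have := T_notU Ty0 Uy; rewrite eqxx.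
move=> z; rewrite mem_cat mem_rev hd => /orP[/sD Dz|tz].
  exact: (one_edge_eq CD).
by rewrite (negbTE (et z tz)) (negbTE (tb z tz)).
Qed.

Lemma covered_T (K : {set V}) y : y \in T -> y \in K -> covered K y.
Proof. by move=> Ty Ky z Tz [->//|eyz]; have := indep Ty Tz; rewrite eyz. Qed.

Lemma covered_U (K : {set V}) z : z \in U -> NT z \subset K -> covered K z.
Proof.
move=> Uz sK y Ty [yz|ezy]; first by have := T_notU Ty Uz; rewrite yz eqxx.
by apply: (subsetP sK); rewrite inE Ty.
Qed.

Lemma covered_leg (K : {set V}) D q x b b0 : D \in components e U ->
  {subset x :: rcons q b <= D} -> {in q, forall z, NT z != set0 -> z = b0} ->
  NT x \subset K -> NT b \subset K -> (b0 \in q -> NT b0 \subset K) ->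
  {in x :: rcons q b, forall z, covered K z}.
Proof.
move=> CD sD qa Kx Kb Kb0 z sz; have [_ Uz] := componentsP e_sym CD (sD z sz).
apply: covered_U => //; move: sz; rewrite inE mem_rcons inE => /or3P[/eqP->|/eqP->|qz] //.
have [->|nz] := eqVneq (NT z) set0; first exact: sub0set.
by move: (qz); rewrite (qa z qz nz) => /Kb0.
Qed.

Section TwoComponents.
Variables (D1 D2 : {set V}) (y1 x1 x2 : V).
Hypotheses (g1 : spread D1) (g2 : spread D2) (ne : D1 != D2) (Ty1 : y1 \in T).
Hypotheses (d1 : x1 \in D1) (d2 : x2 \in D2) (N1 : NT x1 = [set y1]) (N2 : NT x2 = [set y1]).

Let k D := (\sum_(x in D) #|NT x|)./2.
Let C1 : D1 \in components e U. Proof. by case/and3P: g1. Qed.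
Let C2 : D2 \in components e U. Proof. by case/and3P: g2. Qed.
Let e1 : e y1 x1. Proof. by rewrite e_sym; have := set11 y1; rewrite -N1 inE => /andP[]. Qed.
Let e2 : e y1 x2. Proof. by rewrite e_sym; have := set11 y1; rewrite -N2 inE => /andP[]. Qed.

(** The path y0 b .. x1 y1 x2; it meets or sees only y1 and the neighbours
    of b in T. *)
Lemma induced_P5 n : n + (k D1).+1 <= #|T| -> path_with_isolated 5 n.
Proof.
have [q [b [pq sq ab bx qa]]] := leg x1 g1 d1.
have uq := ipath_uniq pq; have Db : b \in D1 by move: ab; rewrite inE => /andP[].
have qx : x1 \notin q by move: uq; rewrite /= mem_rcons inE negb_or => /andP[/andP[]].
move: (ab); rewrite inE Db => /set0Pn[y0]; rewrite inE => /andP[Ty0 eby0] nT.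
have Ux2 := (componentsP e_sym C2 d2).2.
have s2 : {subset [:: x2] <= D2} by move=> z; rewrite inE => /eqP->.
have y0x1 : ~~ e y0 x1.
  by rewrite (one_edge_eq C1 Ty0 Db) // 1?eq_sym // e_sym.
have y01 : y0 != y1 by apply: contraNneq y0x1 => ->.
have y0x2 : ~~ e y0 x2.
  apply: contra y01 => e02; have : y0 \in NT x2 by rewrite inE Ty0 e_sym.
  by rewrite N2 inE.
apply: (@path_with_isolatedI 5 n (y0 :: rev (x1 :: rcons q b) ++ [:: y1; x2]) (y1 |: NT b)).
- apply: (ipath_join_cons C1) => //.
  + exact: (ipath_join C1 C2).
  + by rewrite e_sym.
  + by rewrite !inE negb_or y01 T_notU.
  + by move=> z; rewrite !inE => /orP[] /eqP-> //; apply: indep.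
  + move=> z; rewrite !inE => /orP[] /eqP->.
      by apply: T_notU => //; case: (componentsP e_sym C1 Db).
    by rewrite eq_sym; have [] := components_apart C1 C2 ne Db d2.
- rewrite /= size_cat size_rev /= size_rcons; move: (size q); clear; lia.
- move=> z; rewrite in_cons mem_cat mem_rev => /or3P[/eqP->|sz|].
  + by apply: covered_T => //; rewrite !inE Ty0 eby0 orbT.
  + apply: (covered_leg C1 sq qa _ _ _ sz); rewrite ?N1 ?subsetUr ?subsetUl //.
  + rewrite !inE => /orP[] /eqP->; first by apply: covered_T => //; rewrite !inE eqxx.
    by apply: covered_U => //; rewrite N2 subsetUl.
apply: leq_trans nT; rewrite leq_add2l; have := spread_attach1 g1 ab.
by rewrite cardsU1 -/(k D1); case: (_ \notin _) => //= /leqW.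
Qed.

(** The path y0 b1 .. x1 y1 x2 .. b2 y2; the choice of y0 and y2 excludes
    the chords from y0 to b2 and from y2 to b1. *)
Lemma induced_P7_both q1 b1 c1 q2 b2 c2 n y0 y2 :
  ipath e (x1 :: rcons q1 b1) -> {subset x1 :: rcons q1 b1 <= D1} -> b1 \in attach D1 ->
  {in q1, forall z, NT z != set0 -> z = c1} -> c1 \notin q1 ->
  ipath e (x2 :: rcons q2 b2) -> {subset x2 :: rcons q2 b2 <= D2} -> b2 \in attach D2 ->
  {in q2, forall z, NT z != set0 -> z = c2} -> c2 \notin q2 ->
  y0 \in NT b1 -> y0 \notin NT b2 -> y2 \in NT b2 -> y2 \notin NT b1 ->
  n + (k D1 + k D2).+1 <= #|T| -> path_with_isolated 7 n.
Proof.
move=> pq1 sq1 ab1 qa1 nc1 pq2 sq2 ab2 qa2 nc2 N01 N02 N22 N21 nT.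
have db1 : b1 \in D1 by move: ab1; rewrite inE => /andP[].
have db2 : b2 \in D2 by move: ab2; rewrite inE => /andP[].
have [Ub1 Ub2] : b1 \in U /\ b2 \in U.
  by split; [case: (componentsP e_sym C1 db1) | case: (componentsP e_sym C2 db2)].
have xb1 : x1 != b1 by move: (ipath_uniq pq1); rewrite /= mem_rcons inE negb_or => /andP[/andP[]].
have xb2 : x2 != b2 by move: (ipath_uniq pq2); rewrite /= mem_rcons inE negb_or => /andP[/andP[]].
have [Ty0 e0] : y0 \in T /\ e y0 b1 by move: N01; rewrite inE e_sym => /andP[].
have [Ty2 e22] : y2 \in T /\ e y2 b2 by move: N22; rewrite inE e_sym => /andP[].
have y01 : y0 != y1.
  by apply: contraNneq xb1 => y01; move: e0; rewrite y01 (one_edge_eq C1 Ty1 d1 e1 db1) eq_sym.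
have y21 : y2 != y1.
  by apply: contraNneq xb2 => y21; move: e22; rewrite y21 (one_edge_eq C2 Ty1 d2 e2 db2) eq_sym.
have noadj x q b c y : {in q, forall z, NT z != set0 -> z = c} ->
    c \notin q -> NT x = [set y1] -> y \in T -> y != y1 -> y \notin NT b ->
    {in x :: rcons q b, forall z, ~~ e y z}.
  move=> qa nc Nx Ty yy1 nb z sz; apply/negP=> eyz.
  have Nz : y \in NT z by rewrite inE Ty e_sym.
  move: sz; rewrite inE mem_rcons inE => /or3P[/eqP zx|/eqP zb|qz].
  - by move: Nz; rewrite zx Nx inE (negbTE yy1).
  - by rewrite -zb Nz in nb.
  - by rewrite -(qa z qz) ?qz // in nc; apply/set0Pn; exists y.
pose s := y0 :: rev (x1 :: rcons q1 b1) ++ y1 :: x2 :: rcons (rcons q2 b2) y2.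
apply: (@path_with_isolatedI 7 n s (y1 |: (NT b1 :|: NT b2))).
- apply: (ipath_join_cons C1) => //.
  + apply: (ipath_join_rcons C1 C2) => //; first by rewrite last_rcons.
    exact: (noadj _ _ _ c1).
  + rewrite -rcons_cons in_cons negb_or y01 mem_rcons in_cons negb_or /=.
    apply/andP; split; first by apply: contraNneq N02 => ->.
    by apply/negP=> /sq2 /(componentsP e_sym C2)[_] /(T_notU Ty0); rewrite eqxx.
  + move=> z; rewrite -rcons_cons inE mem_rcons inE => /or3P[/eqP->|/eqP->|sz]; try exact: indep.
    exact: (noadj _ _ _ c2 _ _ _ N2 _ _ _ z sz).
  + move=> z; rewrite -rcons_cons inE mem_rcons inE => /or3P[/eqP->|/eqP->|sz]; try exact: T_notU.
    by rewrite eq_sym; have [] := components_apart C1 C2 ne db1 (sq2 z sz).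
- rewrite /s /= size_cat size_rev /= !size_rcons; move: (size q1) (size q2); clear; lia.
- have c (z : V) : z \in T -> z \in y1 |: (NT b1 :|: NT b2) -> covered (y1 |: (NT b1 :|: NT b2)) z.
    exact: covered_T.
  move=> z; rewrite /s -[x2 :: _]rcons_cons in_cons mem_cat mem_rev [z \in y1 :: _]in_cons mem_rcons [z \in y2 :: _]in_cons.
  move=> /orP[/eqP->|/or4P[sz|/eqP->|/eqP->|sz]].
  + by apply: c => //; rewrite !in_setU N01 orbT.
  + apply: (covered_leg C1 sq1 qa1 _ _ _ sz); rewrite ?N1 ?subsetUl //; last by rewrite (negbTE nc1).
    by rewrite setUCA subsetUl.
  + by apply: c => //; rewrite !inE eqxx.
  + by apply: c => //; rewrite !in_setU N22 !orbT.
  + apply: (covered_leg C2 sq2 qa2 _ _ _ sz); rewrite ?N2 ?subsetUl //; last by rewrite (negbTE nc2).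
    by rewrite setUA subsetUr.
apply: leq_trans nT; rewrite leq_add2l.
have := spread_attach1 g1 ab1; have := spread_attach1 g2 ab2; rewrite -/(k D1) -/(k D2).
have := (leq_card_setU (NT b1) (NT b2)).1; rewrite cardsU1.
move: #|_ :|: _| #|NT b1| #|NT b2| (k D1) (k D2) => a b c k1 k2.
by case: (_ \notin _) => /=; clear; lia.
Qed.

(** Take another leg x2 .. b3 in D2 with b3 <> b2, and a neighbour y4 of b3 in T.  If the
    leg avoids b2, a neighbour y0 of b1 is not adjacent to b3, being adjacent to b2,
    and b3 can replace b2 in the previous lemma.  If it passes through b2, it
    has at least three vertices and b1 .. x1 y1 x2 .. b2 .. b3 y4 is long
    enough without y0; the neighbours of b1 are counted among those of b2. *)
Lemma induced_P7_sub q1 b1 b2 n :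
  ipath e (x1 :: rcons q1 b1) -> {subset x1 :: rcons q1 b1 <= D1} -> b1 \in attach D1 ->
  {in q1, forall z, NT z != set0 -> z = x1} -> x1 \notin q1 ->
  b2 \in attach D2 -> NT b1 \subset NT b2 ->
  n + (k D1 + k D2).+1 <= #|T| -> path_with_isolated 7 n.
Proof.
move=> pq1 sq1 ab1 qa1 nx1 ab2 sN nT.
have [q3 [b3 [pq3 sq3 ab3 b32 qa3]]] := leg b2 g2 d2.
have db2 : b2 \in D2 by move: ab2; rewrite inE => /andP[].
have db3 : b3 \in D2 by move: ab3; rewrite inE => /andP[].
have apart y : y \in NT b2 -> y \notin NT b3.
  rewrite !inE => /andP[Ty ey2]; rewrite Ty /= e_sym (one_edge_eq C2 Ty db2) // e_sym //.
have [y4 N43] : exists y, y \in NT b3 by move: ab3; rewrite inE => /andP[_ /set0Pn].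
have N42 : y4 \notin NT b2 by apply: contraL N43; apply: apart.
have N41 : y4 \notin NT b1 by apply: contra N42; apply: (subsetP sN).
have [y0 N01] : exists y, y \in NT b1 by move: ab1; rewrite inE => /andP[_ /set0Pn].
have N03 : y0 \notin NT b3 by apply: apart; apply: (subsetP sN).
have [q32|q32] := boolP (b2 \in q3); last first.
  exact: (induced_P7_both pq1 sq1 ab1 qa1 nx1 pq3 sq3 ab3 qa3 q32 N01 N03 N43 N41).
have xb3 : x2 != b3 by move: (ipath_uniq pq3); rewrite /= mem_rcons inE negb_or => /andP[/andP[]].
have [Ty4 e43] : y4 \in T /\ e y4 b3 by move: N43; rewrite inE e_sym => /andP[].
have y41 : y4 != y1.
  by apply: contraNneq xb3 => y41; move: e43; rewrite y41 (one_edge_eq C2 Ty1 d2 e2 db3) eq_sym.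
pose K := y1 |: (NT b2 :|: NT b3).
pose s := rev (x1 :: rcons q1 b1) ++ y1 :: x2 :: rcons (rcons q3 b3) y4.
apply: (@path_with_isolatedI 7 n s K).
- apply: (ipath_join_rcons C1 C2) => //; first by rewrite last_rcons.
  move=> z sz; apply/negP=> eyz; have Nz : y4 \in NT z by rewrite inE Ty4 e_sym.
  move: sz; rewrite inE mem_rcons inE => /or3P[/eqP zx|/eqP zb|qz].
  + by move: Nz; rewrite zx N1 inE (negbTE y41).
  + by rewrite -zb Nz in N41.
  + by rewrite -(qa1 z qz) ?qz // in nx1; apply/set0Pn; exists y4.
- have : 0 < size q3 by case: q3 q32 {pq3 sq3 qa3 s}.
  by rewrite /s size_cat size_rev /= !size_rcons; move: (size q1) (size q3); clear; lia.
- move=> z; rewrite /s -[x2 :: _]rcons_cons mem_cat mem_rev [z \in y1 :: _]in_cons mem_rcons [z \in y4 :: _]in_cons.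
  case/or4P=> [sz|/eqP->|/eqP->|sz].
  + apply: (covered_leg C1 sq1 qa1 _ _ _ sz); rewrite ?N1 ?subsetUl //.
    by apply: subset_trans sN _; rewrite /K setUCA subsetUl.
  + by apply: covered_T => //; rewrite !inE eqxx.
  + by apply: covered_T => //; rewrite /K !in_setU N43 !orbT.
  + apply: (covered_leg C2 sq3 qa3 _ _ _ sz); rewrite ?N2 ?subsetUl //.
      by rewrite /K setUA subsetUr.
    by rewrite /K setUCA subsetUl.
apply: leq_trans nT; rewrite leq_add2l.
have b23 : b2 != b3 by rewrite eq_sym.
have := spread_attach2 g2 ab2 ab3 b23; have := spread_half_gt0 g1; rewrite -/(k D1) -/(k D2).
have := (leq_card_setU (NT b2) (NT b3)).1; rewrite cardsU1.
move: #|_ :|: _| #|NT b2| #|NT b3| (k D1) (k D2) => a b c k1 k2.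
by case: (_ \notin _) => /=; clear; lia.
Qed.

End TwoComponents.

Lemma induced_P7 D1 D2 y1 x1 x2 n : spread D1 -> spread D2 -> D1 != D2 -> y1 \in T ->
  x1 \in D1 -> x2 \in D2 -> NT x1 = [set y1] -> NT x2 = [set y1] ->
  n + ((\sum_(x in D1) #|NT x|)./2 + (\sum_(x in D2) #|NT x|)./2).+1 <= #|T| ->
  path_with_isolated 7 n.
Proof.
move=> g1 g2 ne Ty1 d1 d2 N1 N2 nT.
have nin q x b : ipath e (x :: rcons q b) -> x \notin q.
  by move/ipath_uniq; rewrite /= mem_rcons inE negb_or => /andP[/andP[]].
have [q1 [b1 [pq1 sq1 ab1 _ qa1]]] := leg x1 g1 d1.
have [q2 [b2 [pq2 sq2 ab2 _ qa2]]] := leg x2 g2 d2.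
have [n1 n2] := (nin _ _ _ pq1, nin _ _ _ pq2).
have [s12|] := boolP (NT b1 \subset NT b2).
  exact: (induced_P7_sub g1 g2 ne Ty1 d1 d2 N1 N2 pq1 sq1 ab1 qa1 n1 ab2 s12 nT).
have [s21 _|] := boolP (NT b2 \subset NT b1).
  rewrite addnC in nT; rewrite eq_sym in ne.
  by apply: (induced_P7_sub g2 g1 ne Ty1 d2 d1 N2 N1 pq2 sq2 ab2 qa2 n2 ab1 s21); rewrite addnC [X in X.+1]addnC.
move=> /subsetPn[y2 N22 N21] /subsetPn[y0 N01 N02].
exact: (induced_P7_both g1 g2 ne Ty1 d1 d2 N1 N2 pq1 sq1 ab1 qa1 n1 pq2 sq2 ab2 qa2 n2 N01 N02 N22 N21 nT).
Qed.

End PathsThroughBarrier.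

(** * Toughness and connectivity *)

(** Adjacent vertices have the same label, so each component carries one label. *)
Lemma num_comp_labels (H : sgraph) (L : finType) (f : H -> L) :
  (forall x y, adj x y -> f x = f y) -> #|[set f x | x : H]| <= num_comp H.
Proof.
move=> fE; have csym : connect_sym (@adj H) by apply/sym_connect_sym/adj_sym.
have fr x : f (fingraph.root (@adj H) x) = f x.
  have /connectP[p + ->] := connect_root (@adj H) x.
  by elim: p x => //= z p IH x /andP[/fE -> /IH].
apply: leq_trans (_ : #|[set f x | x in fingraph.roots (@adj H)]| <= _).
  apply/subset_leq_card/subsetP=> _ /imsetP[x _ ->]; rewrite -fr.
  by apply: imset_f; apply: (roots_root csym).
apply: leq_trans (leq_imset_card _ _) _.
by rewrite /num_comp /n_comp_mem; apply/subset_leq_card/subsetP=> x; rewrite !inE /= andbT.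
Qed.

Lemma tough_bound (R : realType) (G : sgraph) (Z : {set G}) (x y : G) :
  tough (3%:R / 2%:R : R)%R G -> x != y -> ~~ adj x y -> 1 < num_comp (del Z) ->
  3 * num_comp (del Z) <= 2 * #|Z|.
Proof.
rewrite /tough /toughness => + xy nxy cZ.
rewrite ifF; last first.
  apply/negbTE/negP=> /forallP/(_ x)/forallP/(_ y)/implyP/(_ xy); exact/negP.
move=> /le_trans/(_ (bigmin_le_cond _ _ cZ)); rewrite lee_fin.
have c0 : (0 < (num_comp (del Z))%:R :> R)%R by rewrite ltr0n; apply: ltn_trans cZ.
rewrite ler_pdivlMr // mulrAC ler_pdivrMr ?ltr0n // -!natrM ler_nat [X in _ <= X]mulnC.
by [].
Qed.

(** If x' were outside Z, deleting Z would separate D from x'. *)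
Lemma no_small_separator (G : sgraph) m (Z D : {set G}) x x' :
  k_connected m G -> #|Z| < m -> [disjoint D & Z] ->
  {in D, forall u v, v \notin Z -> adj u v -> v \in D} ->
  x \in D -> x' \notin D -> x' \in Z.
Proof.
case=> _ _ /(_ Z) cZ /cZ[_ conn] dis clo Dx nDx'; apply: contraR nDx' => nZx'.
have nZx : x \notin Z by rewrite (disjointFr dis Dx).
pose u0 : del Z := exist _ x nZx.
have /connectP[p pth E] := conn u0 (exist _ x' nZx').
have -> : x' = val (last u0 p) by rewrite -E.
have Du0 : val u0 \in D by [].
elim: p u0 Du0 pth {E} => //= z p IH u Du /andP[uz]; apply: IH.
by apply: clo Du _ _ uz; exact: (valP z).
Qed.

Lemma min_degree (G : sgraph) m (y : G) : k_connected m G -> m <= #|[set z | adj y z]|.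
Proof.
move=> kG; rewrite leqNgt; apply/negP=> ltm; have [_ ltG _] := kG.
set N := [set z | _] in ltm.
have yN : y \notin N by rewrite inE adj_irrefl.
have [z] : exists z, z \notin y |: N.
  apply/existsP; rewrite -negb_forall; apply/negP=> /forallP all.
  have : #|G| <= #|y |: N| by apply/subset_leq_card/subsetP=> z _; apply: all.
  by rewrite cardsU1 yN; lia.
rewrite !inE negb_or => /andP[zy nz].
have := @no_small_separator G m N [set y] y z kG ltm; rewrite !inE eqxx zy (negbTE nz).
move=> H; have // : false; apply: H => //.
  by rewrite disjoints1.
by move=> u /set1P-> v; rewrite [v \in N]inE => /negbTE->.
Qed.

Section Main.
Variables (G : sgraph) (m : nat).
Local Notation e := (@adj G).
Variables (S T : {set G}).
Let U := ~: (S :|: T).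
Let O := odd_comps e U (degin e T).
Let k (C : {set G}) := (\sum_(x in C) degin e T x)./2.
Hypotheses (disST : [disjoint S & T]) (indep : {in T &, forall y z, ~~ e y z}).
Hypothesis one_edge : {in T, forall y, {in U &, forall x z, e y x -> e y z ->
  component e U x = component e U z -> x = z}}.
Hypothesis inO : {in T, forall y, {in U, forall x, e y x -> component e U x \in O}}.
Hypothesis ltT : #|S| + \sum_(C in O) k C < #|T|.
Hypotheses (kG : k_connected m G) (m1 : 1 < m).

Let disTU : [disjoint T & U].
Proof. by apply/pred0P=> x /=; rewrite !inE; case: (x \in T); rewrite ?orbT. Qed.

Let cases x : [\/ x \in S, x \in T | x \in U].
Proof.
rewrite !inE; have [|_] := boolP (x \in S); first by constructor 1.
by have [|_] := boolP (x \in T); [constructor 2 | constructor 3].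
Qed.

Let OP D : D \in O -> D \in components e U /\ (\sum_(x in D) degin e T x) = (k D).*2.+1.
Proof.
rewrite inE => /andP[CD oD]; split=> //.
by rewrite /k -[LHS]odd_double_half oD.
Qed.

(** If T = set1 y, then S is empty, and y would be a cut vertex, since two of its
    neighbours lie in different components of G - y. *)
Let card_T_gt1 : 1 < #|T|.
Proof.
rewrite ltnNge; apply/negP=> le1.
have T1 : #|T| = 1 by move: le1 ltT; lia.
have S0 : S = set0 by apply/eqP; rewrite -cards_eq0; move: ltT; rewrite T1; lia.
have /cards1P[y Ty] : #|T| == 1 by rewrite T1.
have yT : y \in T by rewrite Ty set11.
have UE z : (z \in U) = (z != y) by rewrite /U S0 set0U Ty !inE.
have /card_gt1P[x [x' [+ + xx']]] := leq_trans m1 (min_degree y kG).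
rewrite !inE => yx yx'.
have Ux : x \in U by rewrite UE; apply: contraTneq yx => ->; rewrite adj_irrefl.
have Ux' : x' \in U by rewrite UE; apply: contraTneq yx' => ->; rewrite adj_irrefl.
have : x' \in [set y].
  apply: (@no_small_separator G m [set y] (component e U x) x) => //.
  - by rewrite cards1.
  - by rewrite disjoint_sym disjoints1; apply: contraTN (yT) => /(subsetP (component_sub e Ux)) Uy; rewrite (disjointFl disTU).
  - move=> u Du v; rewrite inE -UE => Uv uv; have Uu := subsetP (component_sub e Ux) u Du.
    rewrite -(component_eq (@adj_sym G) Du) (component_step (@adj_sym G) Uu Uv uv); exact: component_refl.
  - exact: component_refl.
  - apply: contra xx' => Dx'; apply/eqP/(one_edge yT) => //.
    by rewrite (component_eq (@adj_sym G) Dx').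
by rewrite inE -[_ == _]negbK -UE Ux'.
Qed.

(** If a single edge joins D to T, its end in T together with S separates D from
    the rest of T. *)
Let few_edges D : D \in O -> k D = 0 -> m <= #|S|.+1.
Proof.
move=> DO kD; have [CD sumD] := OP DO; rewrite kD /= in sumD.
have [x Dx wx] : exists2 x, x \in D & odd (degin e T x) by apply: odd_sum_exists; rewrite sumD.
have [y Ty exy] : exists2 y, y \in T & e x y.
  by apply/exists_inP; rewrite -degin_gt0; case: (degin e T x) wx.
have only u y' : u \in D -> y' \in T -> e u y' -> y' = y.
  move=> Du Ty' euy'; apply: contraTeq isT => yy'.
  have sumE := sum_degin_sym (@adj_sym G) T D; rewrite sumD (bigD1 y) //= in sumE.
  rewrite (bigD1 y') ?Ty' //= in sumE.
  have : 0 < degin e D y by rewrite degin_gt0; apply/exists_inP; exists x; rewrite // adj_sym.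
  have : 0 < degin e D y' by rewrite degin_gt0; apply/exists_inP; exists u; rewrite // adj_sym.
  by move: sumE; move: (degin e D y) (degin e D y') (\sum_(_ | _) _) => a b c; clear; lia.
have [y' Ty' yy'] : exists2 y', y' \in T & y' != y.
  have /set0Pn[y'] : T :\ y != set0.
    by rewrite -card_gt0; move: card_T_gt1; rewrite (cardsD1 y) Ty.
  by rewrite !inE => /andP[yy' Ty']; exists y'.
have subDU z : z \in D -> z \in U by move/(componentsP (@adj_sym G) CD)=> [].
have TnU z : z \in T -> z \notin U by move=> Tz; rewrite (disjointFr disTU).
have nSy : y \notin S by rewrite (disjointFl disST).
rewrite -[_.+1]add1n -[1 in X in _ <= X]/(nat_of_bool true) -nSy -cardsU1.
rewrite leqNgt; apply/negP=> ltm.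
have : y' \in y |: S.
  apply: (@no_small_separator G m (y |: S) D x) => //.
  - apply/pred0P=> z /=; apply/negbTE/negP=> /andP[/subDU Uz /setU1P[zy|Sz]].
      by have := TnU y Ty; rewrite -zy Uz.
    by move: Uz; rewrite !inE Sz.
  - move=> u Du v; rewrite !inE negb_or => /andP[vy nSv] uv.
    have [Sv|Tv|Uv] := cases v; first by rewrite Sv in nSv.
      by rewrite (only u v Du Tv uv) eqxx in vy.
    have [DE Uu] := componentsP (@adj_sym G) CD Du.
    by rewrite DE (component_step (@adj_sym G) Uu Uv uv) component_refl.
  - by apply: contraL Ty' => /subDU; apply: contraL; apply: TnU.
by rewrite !inE (negbTE yy') /= (disjointFl disST Ty').
Qed.

(** A vertex of T has neighbours only in S and, at most one each, in the
    odd components. *)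
Let degree_bound : m <= #|S| + #|O|.
Proof.
have /card_gt0P[y Ty] : 0 < #|T| by apply: ltnW card_T_gt1.
apply: leq_trans (min_degree y kG) _; rewrite -(cardsID S) leq_add //.
  by apply/subset_leq_card/subsetP=> z; rewrite inE => /andP[].
set N := _ :\: S.
have NU z : z \in N -> z \in U /\ e y z.
  rewrite !inE => /andP[nSz yz]; split=> //; rewrite negb_or nSz.
  by apply: contraL yz => Tz; apply: indep.
rewrite -(card_in_imset (f := component e U) (D := mem N)).
  apply/subset_leq_card/subsetP=> _ /imsetP[z /NU[Uz yz] ->]; exact: (inO Ty).
move=> u v /NU[Uu yu] /NU[Uv yv]; exact: (one_edge Ty).
Qed.

(** In both cases the odd components other than D1 and D2 make up for what is
    missing in the bound on |S|. *)
Let counting D1 D2 : D1 \in O -> D2 \in O -> D1 != D2 -> m + (k D1 + k D2) <= #|T|.+1.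
Proof.
move=> O1 O2 ne; have := ltT; rewrite (big_setD1 D1 O1) /= (big_setD1 D2) /=; last first.
  by rewrite in_setD1 eq_sym ne.
set rest := \sum_(_ in _) _ => lt.
have [/exists_inP[D DO /eqP kD]|] := boolP [exists D in O, k D == 0].
  have := few_edges DO kD; move: lt.
  by move: #|S| #|T| (k D1) (k D2) rest => s t a b r; clear; lia.
rewrite negb_exists_in => /forall_inP kpos.
have := degree_bound; have -> : #|O| = #|O :\ D1 :\ D2|.+2.
  by rewrite (cardsD1 D1) O1 (cardsD1 D2 (O :\ D1)) !in_setD1 eq_sym ne O2.
have : #|O :\ D1 :\ D2| <= rest.
  rewrite -sum1_card; apply: leq_sum => C; rewrite !in_setD1 => /and3P[_ _ /kpos].
  by rewrite lt0n.
move: lt; move: #|S| #|T| #|_ :\ _ :\ _| (k D1) (k D2) rest => s t o a b r; clear; lia.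
Qed.

Local Notation NT := (nbr e T).
Let uniqs (D : {set G}) : {set G} := [set x in D | #|NT x| == 1].
(** In each component one vertex with a single neighbour in T is spared; W
    contains the other attached vertices, so that every component keeps at most one
    edge to T. *)
Let kept (D : {set G}) : option G := [pick x in uniqs D].
Let W : {set G} := [set x in U | (NT x != set0) && (Some x != kept (component e U x))].

(** Attached vertices outside uniqs D account for two edges or more. *)
Let attach_uniq D : 2 * #|attach e T D| <= #|uniqs D| + \sum_(x in D) #|NT x|.
Proof.
have cE (P : pred G) : #|[set x in D | P x]| = \sum_(x in D) P x.
  rewrite -sum1_card big_set /= big_mkcondr /=; by apply: eq_bigr => x _; case: (P x).
rewrite /attach /uniqs !cE big_distrr -big_split; apply: leq_sum => x _ /=.
by rewrite -card_gt0 -/(NT x); case: #|NT x| => [|[|n]].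
Qed.

(** If D is not spread it has at most k + 1 attached vertices, one of which is
    spared unless uniqs D is empty; in that case there are at most k. *)
Let card_W_comp D : D \in O ->
  2 * #|[set x in W | x \in D]| <= 2 * k D + spread e T U D * #|uniqs D|.
Proof.
move=> DO; have [CD sumD] := OP DO; have au := attach_uniq D.
rewrite (eq_bigr (degin e T)) // sumD in au.
have spE : spread e T U D = (k D + 2 <= #|attach e T D|).
  rewrite /spread CD (eq_bigr (degin e T)) // sumD /= uphalf_double.
  by rewrite odd_double.
have WD : [set x in W | x \in D] \subset attach e T D.
  by apply/subsetP=> x; rewrite !inE => /andP[/and3P[_ -> _] ->].
have [u0|] := eqVneq (uniqs D) set0.
  have := subset_leq_card WD; move: au; rewrite u0 cards0 muln0.
  by move: #|attach _ _ _| #|[set _ in _ | _]| (k D) => a w c; clear; lia.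
rewrite -card_gt0 => u0.
have [r kr ur] : exists2 r, kept D = Some r & r \in uniqs D.
  rewrite /kept; case: pickP => [r ur|nu]; first by exists r.
  by move: u0; rewrite card_gt0 => /set0Pn[r]; rewrite nu.
have ar : r \in attach e T D.
  by move: ur; rewrite !inE => /andP[-> /= /eqP c1]; rewrite -card_gt0 c1.
have WD' : [set x in W | x \in D] \subset attach e T D :\ r.
  rewrite subsetD1 WD /= inE negb_and [r \in W]inE.
  have [Dr|] := boolP (r \in D); last by rewrite orbT.
  by rewrite orbF !negb_and negbK -(componentsP (@adj_sym G) CD Dr).1 kr eqxx !orbT.
have := subset_leq_card WD'; have := cardsD1 r (attach e T D); rewrite ar.
move: au; rewrite spE; move: u0.
move: #|attach _ _ _| #|attach _ _ _ :\ r| #|[set _ in _ | _]| (k D) #|uniqs D| => a a' w c u.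
by case: leqP => /=; clear; lia.
Qed.

Let B : {set G} := [set x in U | spread e T U (component e U x) && (#|NT x| == 1)].

Let card_W : 2 * #|W| <= 2 * (\sum_(C in O) k C) + #|B|.
Proof.
have sE (Q : {set G}) : Q \subset U -> (forall x, x \in Q -> NT x != set0) ->
    #|Q| = \sum_(C in O) #|[set x in Q | x \in C]|.
  move=> QU Qatt.
  have cE (A : {set G}) : #|[set x in Q | x \in A]| = \sum_(x in A) (x \in Q).
    rewrite -sum1_card big_set /= (eq_bigl (fun x => (x \in A) && (x \in Q))); last by move=> x; rewrite andbC.
    by rewrite big_mkcondr /=; apply: eq_bigr => x _; case: (x \in Q).
  have -> : #|Q| = \sum_(x in U) (x \in Q).
    rewrite -cE; congr #|pred_of_set _|; apply/setP=> x; rewrite in_set.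
    by have [/(subsetP QU)->|] := boolP (x \in Q).
  rewrite (sum_components (@adj_sym G)) (bigID (mem O)) /= [X in _ + X]big1 ?addn0; last first.
    move=> C /andP[CU nCO]; apply: big1 => x Cx; apply/eqP; rewrite eqb0.
    have [CE Ux] := componentsP (@adj_sym G) CU Cx.
    apply: contra nCO => /Qatt/set0Pn[y]; rewrite inE => /andP[Ty xy].
    by rewrite CE; apply: (inO Ty) => //; rewrite adj_sym.
  rewrite (eq_bigl (fun C => C \in O)) => [|C]; last first.
    by rewrite andbC; have [|//] := boolP (C \in O); rewrite inE => /andP[->].
  by apply: eq_bigr => C _; rewrite cE.
rewrite (sE W) ?(sE B).
- rewrite !big_distrr -big_split /=; apply: leq_sum => C CO.
  apply: leq_trans (card_W_comp CO) _; rewrite leq_add2l.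
  have [sC|_] := boolP (spread e T U C); last by rewrite mul0n.
  rewrite mul1n; apply/subset_leq_card/subsetP=> x; rewrite !inE => /andP[Cx ->].
  have [CU _] := OP CO; have [CE Ux] := componentsP (@adj_sym G) CU Cx.
  by rewrite -CE Cx sC !andbT; move: Ux; rewrite !inE.
- by apply/subsetP=> x; rewrite inE => /andP[].
- by move=> x; rewrite inE => /and3P[_ _ /eqP c1]; rewrite -card_gt0 c1.
- by apply/subsetP=> x; rewrite inE => /andP[].
- by move=> x; rewrite inE => /and3P[].
Qed.

(** Label a vertex of T by itself, and a vertex of U by the only vertex of T to
    which its component is still joined, if any. *)
Let many_components : #|T| <= num_comp (del (S :|: W)).
Proof.
pose lab (z : G) : option G := if z \in T then Some z else
  obind (fun x => [pick y in NT x]) (kept (component e U z)).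
have labE : forall x y : del (S :|: W), adj x y -> lab (val x) = lab (val y).
  have TU y z : y \in T -> z \in U -> z \notin W -> e y z -> lab y = lab z.
    move=> Ty Uz nWz yz; have nTz : z \notin T by rewrite (disjointFl disTU).
    have Ny : y \in NT z by rewrite inE Ty adj_sym.
    have kz : kept (component e U z) = Some z.
      move: nWz; rewrite [z \in W]in_set Uz /= negb_and !negbK => /orP[/eqP N0|/eqP//].
      by rewrite N0 inE in Ny.
    rewrite /lab Ty (negbTE nTz) kz /=.
    have /cards1P[y' Ny'] : #|NT z| == 1.
      by move: kz; rewrite /kept; case: pickP => // u; rewrite inE => /andP[_ c1] [<-].
    have -> : y = y' by move: Ny; rewrite Ny' inE => /eqP.
    case: pickP => [u|/(_ y')]; rewrite Ny' inE; first by move/eqP->.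
    by rewrite eqxx.
  have nZ (z : del (S :|: W)) : val z \notin S /\ val z \notin W.
    by have := valP z; rewrite in_setU negb_or => /andP.
  move=> x y; have [nSu nWu] := nZ x; have [nSv nWv] := nZ y.
  rewrite -[adj x y]/(e (val x) (val y)).
  move: (val x) (val y) nSu nWu nSv nWv => u v nSu nWu nSv nWv uv.
  have [Su|Tu|Uu] := cases u; first by rewrite Su in nSu.
    have [Sv|Tv|Uv] := cases v; first by rewrite Sv in nSv.
      by have := indep Tu Tv; rewrite uv.
    exact: TU.
  have [Sv|Tv|Uv] := cases v; first by rewrite Sv in nSv.
    by apply/esym/TU => //; rewrite adj_sym.
  by rewrite /lab !(disjointFl disTU) // (component_step (@adj_sym G) Uu Uv uv).
apply: leq_trans (num_comp_labels labE).
rewrite -(card_imset _ (@Some_inj _)); apply/subset_leq_card/subsetP=> _ /imsetP[y Ty ->].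
have nZ : y \notin S :|: W.
  rewrite in_setU negb_or (disjointFl disST Ty) /=.
  by rewrite [y \in W]in_set (disjointFr disTU Ty).
by apply/imsetP; exists (exist _ y nZ); rewrite //= /lab Ty.
Qed.

Hypothesis tough32 : forall (Z : {set G}) (x y : G),
  x != y -> ~~ e x y -> 1 < num_comp (del Z) -> 3 * num_comp (del Z) <= 2 * #|Z|.

(** By toughness, B has more than |T| elements, while each of them determines
    one vertex of T. *)
Let common_neighbour : exists D1 D2 y1 x1 x2,
  [/\ spread e T U D1, spread e T U D2, D1 != D2 & y1 \in T]
  /\ [/\ x1 \in D1, x2 \in D2, NT x1 = [set y1] & NT x2 = [set y1]].
Proof.
have [y [y' [Ty Ty' yy']]] := card_gt1P card_T_gt1.
have tgh := tough32 yy' (indep Ty Ty') (leq_trans card_T_gt1 many_components).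
have cS : #|S :|: W| <= #|S| + #|W| by rewrite (leq_card_setU S W).1.
have ltB : #|T| < #|B|.
  move: tgh many_components ltT card_W cS; move: (num_comp _) #|S :|: W| => c z.
  by move: #|S| #|T| #|W| #|B| (\sum_(C in O) k C) => s t w b r; clear; lia.
have /dinjectivePn[x1 Bx1 [x2 /andP[/= x21 Bx2] E]] : ~~ dinjectiveb NT B.
  apply: contraL ltB => /dinjectiveP/card_in_imset <-; rewrite -leqNgt.
  apply: leq_trans (leq_imset_card (@set1 G) (mem T)); apply/subset_leq_card/subsetP.
  move=> _ /imsetP[x Bx ->]; move: Bx; rewrite inE => /and3P[_ _ /cards1P[z Nz]].
  have : z \in NT x by rewrite Nz set11.
  by rewrite inE => /andP[Tz _]; rewrite Nz; apply: imset_f.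
move: Bx1 Bx2; rewrite [x1 \in B]in_set [x2 \in B]in_set.
move=> /and3P[Ux1 g1 /cards1P[y1 N1]] /and3P[Ux2 g2 _].
have N2 : NT x2 = [set y1] by rewrite -E.
have [Ty1 e1] : y1 \in T /\ e y1 x1.
  by have := set11 y1; rewrite -N1 inE adj_sym => /andP.
have e2 : e y1 x2 by have := set11 y1; rewrite -N2 inE adj_sym => /andP[].
exists (component e U x1), (component e U x2), y1, x1, x2.
split; split=> //; try exact: component_refl.
by apply: contra x21 => /eqP cE; apply/eqP/esym/(one_edge Ty1).
Qed.

Lemma tidy_barrier_path l n : l = 2 \/ l = 3 -> m = n + l - 1 ->
  path_with_isolated e T (2 * l + 1) n.
Proof.
have [D1 [D2 [y1 [x1 [x2 [[g1 g2 ne Ty1] [d1 d2 N1 N2]]]]]]] := common_neighbour.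
have inOs D : spread e T U D -> D \in O by case/and3P=> CD oD _; rewrite inE CD.
have cnt := counting (inOs _ g1) (inOs _ g2) ne.
have k2 : 0 < k D2 by apply: (spread_half_gt0 g2).
case=> -> mE.
  apply: (induced_P5 (@adj_sym G) disTU indep one_edge g1 g2 ne Ty1 d1 d2 N1 N2).
  rewrite -/(k D1); move: cnt k2; rewrite mE; move: #|T| (k D1) (k D2) => t a b; clear; lia.
apply: (induced_P7 (@adj_sym G) disTU indep one_edge g1 g2 ne Ty1 d1 d2 N1 N2).
rewrite -/(k D1) -/(k D2); move: cnt; rewrite mE; move: #|T| (k D1) (k D2) => t a b; clear; lia.
Qed.

End Main.

Lemma induced_copy_path (G : sgraph) (T : {set G}) n p k :
    {in T &, forall y z, ~~ adj y z} -> 0 < p <= n ->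
    path_with_isolated (@adj G) T n k ->
  induced_copy (disjoint_union (path_graph p) (copies k (path_graph 1))) G.
Proof.
move=> indep /andP[p0 le_pn] [s [I [ps ns sIT kI apart]]].
have le_ps := leq_trans le_pn ns.
have [x0 _] : exists x0 : G, x0 \in s.
  case: s le_ps {ps ns apart} => [|x s _]; first by rewrite leqNgt p0.
  by exists x; apply: mem_head.
have ltp (i : 'I_p) : i < size s by apply: leq_trans le_ps.
have ltk (j : 'I_k) : j < size (enum I) by rewrite -cardE; apply: leq_trans kI.
have inI (j : 'I_k) : nth x0 (enum I) j \in I by rewrite -mem_enum mem_nth.
pose f (z : disjoint_union (path_graph p) (copies k (path_graph 1))) : G :=
  match z with inl i => nth x0 s (i : 'I_p) | inr u => nth x0 (enum I) (u.1 : 'I_k) end.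
have Ap (i : 'I_p) (u : 'I_k) : nth x0 (enum I) u != nth x0 s i /\
    ~~ adj (nth x0 (enum I) u) (nth x0 s i).
  by apply: apart; [apply: inI | apply: mem_nth].
exists f; split.
  case=> [i|[u a]] [j|[v b]] /= E.
  - by congr inl; apply/val_inj/eqP; rewrite /= -(nth_uniq x0 (ltp i) (ltp j) (ipath_uniq ps)) E.
  - by have [] := Ap i v; rewrite E eqxx.
  - by have [] := Ap j u; rewrite E eqxx.
  congr inr; congr (_, _); last by rewrite [a]ord1 [b]ord1.
  by apply/val_inj/eqP; rewrite /= -(nth_uniq x0 (ltk u) (ltk v) (enum_uniq _)) E.
case=> [i|[u a]] [j|[v b]] /=.
- rewrite /path_adj; case: (ltngtP i j) => ij.
  + rewrite (ipath_nth x0 ps ij) //; case: (_ == _) => //=.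
    by apply/esym/negbTE; rewrite neq_ltn; move: ij; clear; lia.
  + rewrite adj_sym (ipath_nth x0 ps ij) // orbC; case: (_ == _) => //=.
    by apply/esym/negbTE; rewrite neq_ltn; move: ij; clear; lia.
  + by rewrite ij adj_irrefl !(gtn_eqF (ltnSn _)).
- by rewrite adj_sym; apply/negbTE; case: (Ap i v).
- by apply/negbTE; case: (Ap j u).
rewrite /copies_adj /= /path_adj [a]ord1 [b]ord1 /= andbF; apply/negbTE/indep;
  exact/(subsetP sIT)/inI.
Qed.

(** Allowing shorter paths P_p covers both parts of the theorem. *)
Lemma tough_path_free_two_factor (R : realType) (l k : nat) (G : sgraph) p : l = 2 \/ l = 3 ->
  0 < k -> tough (3%:R / 2%:R : R)%R G -> k_connected (k + l - 1) G ->
  0 < p <= 2 * l + 1 ->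
  is_free (disjoint_union (path_graph p) (copies k (path_graph 1))) G ->
  has_two_factor G.
Proof.
move=> l23 k0 tG kG lep freeG.
have [//|[S [T0 /tidy_barrier[||T [disST indep one_edge inO ltT]]]]] :=
  two_factor_or_barrier (@adj_sym G) (@adj_irrefl G).
- exact: adj_sym.
- exact: adj_irrefl.
case: freeG; apply: (induced_copy_path indep lep).
apply: (@tidy_barrier_path G (k + l - 1) S T disST indep one_edge inO ltT kG) => //.
  by case: l23 => ->; move: k0; clear; lia.
by move=> Z x y; apply: (tough_bound tG).
Qed.

Theorem theorem4 (R : realType) :
  (forall (l k : nat) (G : sgraph),
     l = 2 \/ l = 3 ->
     0 < k ->
     tough (3%:R / 2%:R : R)%R G ->
     k_connected (k + l - 1) G ->
     is_free (disjoint_union (path_graph (2 * l + 1)) (copies k (path_graph 1)))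
       G ->
     3 <= #|G| ->
     has_two_factor G)
  /\
  (forall (k : nat) (G : sgraph),
     0 < k ->
     tough (3%:R / 2%:R : R)%R G ->
     k_connected (k + 2) G ->
     is_free (disjoint_union (path_graph 6) (copies k (path_graph 1))) G ->
     3 <= #|G| ->
     has_two_factor G).
Proof.
split=> [l k G l23 k0 tG kG freeG _|k G k0 tG kG freeG _].
  by apply: (tough_path_free_two_factor l23 k0 tG kG _ freeG); rewrite addn1 ltn0Sn leqnn.
apply: (@tough_path_free_two_factor R 3 k G 6) => //; first by right.
by rewrite -addnBA.
Qed.
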